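(* Let $N\ge1$, $\alpha\in(0,1)$, $2\alpha<N\le4\alpha$, $2_\alpha^*=\frac{2N}{N-2\alpha}$. For any $\omega\in X^\alpha(\mathbb{R}_+^{N+1})$, $\sigma>0$ and $x_0\in\mathbb{R}^N$, consider the scaled function $$\omega_\sigma(x,y)=\sigma^{\frac{N-2\alpha}{2}}\,\omega(\sigma(x-x_0),\sigma y).$$ Then this scaling preserves the norms $\|\cdot\|_{\dot X^\alpha}$ and $|\cdot(x,0)|_{2_\alpha^*}$, i.e. $\|\omega_\sigma\|_{\dot X^\alpha}=\|\omega\|_{\dot X^\alpha}$ and $|\omega_\sigma(\cdot,0)|_{2_\alpha^*}=|\omega(\cdot,0)|_{2_\alpha^*}$.
   Context: $\mathbb{R}_+^{N+1}=\mathbb{R}^N\times(0,\infty)$ with points $(x,y)$. $\|\omega\|_{\dot X^\alpha}^2=\int_{\mathbb{R}_+^{N+1}}y^{1-2\alpha}|\nabla\omega|^2dxdy$ and $\|\omega\|_{X^\alpha}^2=\|\omega\|_{\dot X^\alpha}^2+\int_{\mathbb{R}^N}|\omega(x,0)|^2dx$; $X^\alpha(\mathbb{R}_+^{N+1})$ is the completion of the smooth compactly supported functions on $\overline{\mathbb{R}_+^{N+1}}$ under $\|\cdot\|_{X^\alpha}$. $\omega(\cdot,0)$ is the trace of $\omega$ on $\mathbb{R}^N\times\{0\}$, and $|\cdot|_r$ is the $L^r(\mathbb{R}^N)$ norm. *)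

(* Defs.v *)
From HB Require Import structures.
From mathcomp Require Import all_boot all_order all_algebra.
From mathcomp Require Import all_classical all_reals all_analysis.

Set Implicit Arguments.
Unset Strict Implicit.
Unset Printing Implicit Defensive.

Import Order.TTheory GRing.Theory Num.Theory.
Import numFieldNormedType.Exports.

Local Open Scope classical_set_scope.
Local Open Scope ring_scope.

(* MathComp-Analysis has the norm and the topology of 'rV[R]_n but neither a
   sigma-algebra nor a Lebesgue measure on it.  The sigma-algebra below is the
   one generated by the n coordinates, i.e. the Borel one. *)
Section measurable_rV.
Context {R : realType} {n : nat}.

Let coors (i : 'I_n) (x : 'rV[R]_n) : measurableTypeR R := x ord0 i.

Let rV_set0 : g_sigma_preimage coors set0.
Proof. exact: sigma_algebra0. Qed.

Let rV_setC A : g_sigma_preimage coors A -> g_sigma_preimage coors (~` A).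
Proof. exact: sigma_algebraC. Qed.

Let rV_bigcup (F : (set 'rV[R]_n)^nat) :
  (forall i, g_sigma_preimage coors (F i)) ->
  g_sigma_preimage coors (\bigcup_i (F i)).
Proof. exact: sigma_algebra_bigcup. Qed.

HB.instance Definition _ := @isMeasurable.Build
  (measure_tuple_display default_measure_display)
  'rV[R]_n (g_sigma_preimage coors) rV_set0 rV_setC rV_bigcup.

Lemma measurable_coord (i : 'I_n) :
  measurable_fun [set: 'rV[R]_n] (fun x : 'rV[R]_n => x ord0 i).
Proof.
move=> _ Y mY; rewrite setTI; apply: sub_sigma_algebra => /=.
rewrite -bigcup_seq/=; exists i => /=; first by rewrite mem_index_enum.
by exists Y => //; rewrite setTI.
Qed.

Lemma measurable_fun_coordP d (T : measurableType d) (f : T -> 'rV[R]_n) :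
  (forall i, measurable_fun [set: T] (fun t => f t ord0 i)) ->
  measurable_fun [set: T] f.
Proof.
move=> mf.
suff H : g_sigma_preimage (fun i => coors i \o f) `<=` measurable.
  move=> _ A mA; apply: H; rewrite g_sigma_preimage_comp.
  by exists A.
apply: smallest_sub; first exact: sigma_algebra_measurable.
move=> A; rewrite -bigcup_seq/= => -[i _ [B mB <-]].
exact: mf.
Qed.

End measurable_rV.

Section lebesgue_rV.
Context {R : realType}.
Local Notation mR := (measurableTypeR R).

Definition cons_rV n (p : (mR * 'rV[R]_n)%type) : 'rV[R]_n.+1 :=
  \row_(i < n.+1) oapp (fun j => p.2 ord0 j) p.1 (unlift ord0 i).

Lemma measurable_cons_rV n : measurable_fun [set: (mR * 'rV[R]_n)%type] (@cons_rV n).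
Proof.
apply: measurable_fun_coordP => i; rewrite /cons_rV.
case: (unliftP ord0 i) => [j ->|->].
- rewrite (_ : (fun _ => _) = (fun x : 'rV[R]_n => x ord0 j) \o snd).
    by apply: measurableT_comp; [exact: measurable_coord|exact: measurable_snd].
  by apply/funext => p /=; rewrite mxE liftK.
- rewrite (_ : (fun _ => _) = fst); first exact: measurable_fst.
  by apply/funext => p /=; rewrite mxE unlift_none.
Qed.

Definition uncons_rV n (x : 'rV[R]_n.+1) : (mR * 'rV[R]_n)%type :=
  (x ord0 ord0, \row_j x ord0 (lift ord0 j)).

Lemma measurable_uncons_rV n : measurable_fun [set: 'rV[R]_n.+1] (@uncons_rV n).
Proof.
apply: measurable_fun_pair; first exact: measurable_coord.
apply: measurable_fun_coordP => i.
rewrite (_ : (fun _ => _) = (fun x : 'rV[R]_n.+1 => x ord0 (lift ord0 i))).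
  exact: measurable_coord.
by apply/funext => x /=; rewrite mxE.
Qed.

Lemma cons_rVK n : cancel (@cons_rV n) (@uncons_rV n).
Proof.
move=> [a v]; rewrite /uncons_rV /cons_rV; congr pair.
  by rewrite mxE unlift_none.
by apply/rowP => j; rewrite !mxE liftK.
Qed.

HB.instance Definition _ n :=
  @isMeasurableFun.Build _ _ _ _ (@cons_rV n) (@measurable_cons_rV n).

Section cons_measure.
Variables (n : nat) (mu : {sigma_finite_measure set 'rV[R]_n -> \bar R}).

Definition cons_measure : set 'rV[R]_n.+1 -> \bar R :=
  pushforward (lebesgue_measure \x mu)%E (@cons_rV n).

HB.instance Definition _ := Measure.copy cons_measure
  (measure_function_pushforward__canonical__measure_function_Measure
     (lebesgue_measure \x mu)%E
     (@measurable_cons_rV n)).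

Let sigma_finite_cons_measure : sigma_finite setT cons_measure.
Proof.
have /sigma_finiteP[F [TF ndF Foo]] := sigma_finiteT (@lebesgue_measure R).
have /sigma_finiteP[G [TG ndG Goo]] := sigma_finiteT mu.
exists (fun k => @uncons_rV n @^-1` (F k `*` G k)).
  rewrite -preimage_bigcup (_ : \bigcup_k _ = setT) ?preimage_setT//.
  rewrite -setXTT TF TG predeqE => -[x y]; split.
    by move=> [/= k _ [Fkx Gky]]; split; exists k.
  move=> [/= [k _ Fkx] [l _ Gly]]; exists (maxn k l) => //; split.
  - by move: x Fkx; exact/subsetPset/ndF/leq_maxl.
  - by move: y Gly; exact/subsetPset/ndG/leq_maxr.
move=> k; have [? ?] := Foo k; have [? ?] := Goo k; split.
  rewrite -[X in measurable X]setTI; apply: measurable_uncons_rV => //.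
  exact: measurableX.
rewrite /cons_measure /pushforward -comp_preimage (_ : _ \o _ = id).
  by rewrite preimage_id product_measure1E// lte_mul_pinfty// ge0_fin_numE.
by apply/funext => p; exact: cons_rVK.
Qed.

HB.instance Definition _ := @Measure_isSigmaFinite.Build _ _ _
  cons_measure sigma_finite_cons_measure.
End cons_measure.

Fixpoint lebesgue_rV n : {sigma_finite_measure set 'rV[R]_n -> \bar R} :=
  match n with
  | 0 => \d_(0 : 'rV[R]_0)
  | n.+1 => cons_measure (lebesgue_rV n)
  end.
End lebesgue_rV.

Section half_space.
Context {R : realType} {N : nat}.
Local Notation mR := (measurableTypeR R).
Implicit Types (alpha sigma : R) (phi w : 'rV[R]_N * R -> R).
Implicit Types (G : 'rV[R]_N * R -> 'rV[R]_N * R) (u : 'rV[R]_N -> R).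

Definition half_space : set ('rV[R]_N * R) := [set p | 0 < p.2].

Definition lebesgue_half : {measure set ('rV[R]_N * mR)%type -> \bar R} :=
  (lebesgue_rV N \x lebesgue_measure)%E.

Fixpoint Ck (V : normedModType R) (k : nat) (f : V -> R) : Prop :=
  match k with
  | 0 => continuous f
  | k.+1 => [/\ continuous f, forall x v, derivable f x v
             & forall v : V, Ck k (fun x => 'D_v f x)]
  end.

(* A smooth compactly supported function on the closed half-space is the
   restriction of an element of C_c^oo(R^N x R).  We keep the extension, but
   only its values on the closed half-space are used below. *)
Definition test_function phi : Prop :=
  (forall k, Ck k phi) /\ compact (closure [set p | phi p != 0]).

Definition gradient phi (p : 'rV[R]_N * R) : 'rV[R]_N * R :=
  (\row_i 'D_(delta_mx 0 i, 0) phi p, 'D_(0, 1) phi p).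

(* The norm of the library on 'rV[R]_N * R is the sup norm. *)
Definition sq_euclid (v : 'rV[R]_N * R) : R :=
  \sum_i v.1 ord0 i ^+ 2 + v.2 ^+ 2.

Definition energy alpha G : \bar R :=
  (\int[lebesgue_half]_(p in half_space)
     (p.2 `^ (1 - 2 * alpha) * sq_euclid (G p))%:E)%E.

Definition sq_L2 u : \bar R := (\int[lebesgue_rV N]_x (u x ^+ 2)%:E)%E.

Definition restrict0 phi (x : 'rV[R]_N) : R := phi (x, 0).

Definition sq_Xnorm alpha phi : \bar R :=
  (energy alpha (gradient phi) + sq_L2 (restrict0 phi))%E.

Definition X_cauchy alpha (s : nat -> 'rV[R]_N * R -> R) : Prop :=
  forall e : R, 0 < e -> exists n0, forall m n, (n0 <= m)%N -> (n0 <= n)%N ->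
    (sq_Xnorm alpha (fun p => s m p - s n p)%R < (e ^+ 2)%:E)%E.

(* The completion X^alpha is realized as a space of functions on the open
   half-space: for 0 < alpha < 1, a sequence of test functions that is Cauchy
   for the X^alpha norm converges in L^2_loc, hence a.e. along a subsequence,
   and its class in the completion is determined by the limit function.
   Functions equal a.e. on the half-space stand for the same element. *)
Definition represents alpha (s : nat -> 'rV[R]_N * R -> R) w : Prop :=
  [/\ forall n : nat, test_function (s n),
      X_cauchy alpha s
    & {ae lebesgue_half, forall p, half_space p ->
        s n p @[n --> \oo] --> w p}].

Definition Xspace alpha : set ('rV[R]_N * R -> R) :=
  [set w | exists s, represents alpha s w].

(* The gradient and the trace of an element of X^alpha are the limits of the
   gradients and of the restrictions to y = 0 of representing sequences, in
   L^2(y^(1 - 2 alpha) dx dy) and in L^2(R^N).  They are defined up to a.e.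
   equality. *)
Definition is_Xgradient alpha w G : Prop :=
  measurable_fun [set: ('rV[R]_N * mR)%type]
    (G : 'rV[R]_N * mR -> 'rV[R]_N * mR)%type /\
  exists2 s, represents alpha s w &
    energy alpha (fun p => gradient (s n) p - G p) @[n --> \oo] --> 0%E.

Definition Xgradient alpha w : 'rV[R]_N * R -> 'rV[R]_N * R :=
  xget (fun=> 0) (is_Xgradient alpha w).

Definition is_Xtrace alpha w u : Prop :=
  measurable_fun [set: 'rV[R]_N] (u : 'rV[R]_N -> mR) /\
  exists2 s, represents alpha s w &
    sq_L2 (fun x => restrict0 (s n) x - u x) @[n --> \oo] --> 0%E.

Definition Xtrace alpha w : 'rV[R]_N -> R :=
  xget (fun=> 0) (is_Xtrace alpha w).

Definition Xdot_norm alpha w : \bar R :=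
  (energy alpha (Xgradient alpha w) `^ 2^-1)%E.

Definition rescale alpha sigma (x0 : 'rV[R]_N) w (p : 'rV[R]_N * R) : R :=
  sigma `^ ((N%:R - 2 * alpha) / 2) * w (sigma *: (p.1 - x0), sigma * p.2).

Definition critical_exponent alpha : R := 2 * N%:R / (N%:R - 2 * alpha).

End half_space.
Arguments critical_exponent {R} N alpha.

(* Main.v *)
(* Idea.  The change of variables p |-> (sigma (x - x0), sigma y) multiplies
   Lebesgue measure on the half-space by sigma^-(N+1), the weight y^(1-2 alpha)
   by a power of sigma and gradients by sigma, and the exponents cancel; hence a
   gradient (trace) of w is transported to a gradient (trace) of the rescaled
   function, and conversely since rescaling is invertible.  Gradient and trace
   are chosen limits, so what remains is that they are determined a.e. by w: if
   test functions t_n tend to 0 a.e. and are Cauchy, their gradients and traces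
   can only tend to 0.
   - Gradient: if 'D_e t_n --> h in weighted L^2 then by Fatou, for almost every
     p, the functions s |-> 'D_e t_n (p + s e) approach h (p + s e) in L^2(0,1)
     along a subsequence while t_n (p + s e) --> 0 for a.e. s, so all primitives
     of h along the line vanish; Tonelli then gives h = 0 a.e.
   - Trace: |t(x,y) - t(x,0)|^2 is at most y^(2 alpha) / (2 alpha) times the
     vertical energy above x, so the trace is controlled by t_n at almost every
     small height y plus an error that vanishes with y. *)
Require Import Defs.
From HB Require Import structures.
From mathcomp Require Import all_boot all_order all_algebra.
From mathcomp Require Import all_classical all_reals all_analysis.
From mathcomp Require Import measurable_realfun.
From mathcomp Require Import ring lra.

Set Implicit Arguments.
Unset Strict Implicit.
Unset Printing Implicit Defensive.

Import Order.TTheory GRing.Theory Num.Theory.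
Import numFieldNormedType.Exports.

Local Open Scope classical_set_scope.
Local Open Scope ring_scope.

(** * Affine changes of variables *)

Section affine_change_of_variables.
Context {R : realType}.
Local Notation mR := (measurableTypeR R).

Lemma measurable_affine (s c : R) :
  measurable_fun [set: mR] (fun x : mR => s * (x - c) : mR).
Proof. by apply: measurable_funM => //; exact: measurable_funB. Qed.

(** Lebesgue measure is [s] times its pushforward under the affine map: both agree on half-open
    intervals, and uniqueness of the extension does the rest. *)
Lemma ge0_integral_affine (s c : R) (f : mR -> \bar R) : 0 < s ->
  measurable_fun [set: mR] f -> (forall x, (0 <= f x)%E) ->
  (\int[lebesgue_measure]_x f (s * (x - c))%R =
   s^-1%:E * \int[lebesgue_measure]_x f x)%E.
Proof.
move=> s0 mf f0.
pose phi : mR -> mR := fun x => s * (x - c).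
have mphi : measurable_fun setT phi by exact: measurable_affine.
pose nu : {measure set mR -> \bar R} := mscale (NngNum (ltW s0))
  (measure_function_pushforward__canonical__measure_function_Measure
     (@lebesgue_measure R) mphi).
have nuE (A : set mR) : measurable A -> lebesgue_measure A = nu A.
  move=> mA; apply: lebesgue_measure_unique => // _ [[a b]] _ <-/=.
  rewrite /nu /= /mscale/= /pushforward/=.
  rewrite (_ : _ @^-1` _ = [set` `]a / s + c, b / s + c]]); last first.
    apply/seteqP; split => x /=; rewrite !in_itv/= /phi.
      by rewrite -ltrBrDr -lerBlDr ltr_pdivrMr// ler_pdivlMr// mulrC.
    by rewrite -ltrBrDr -lerBlDr ltr_pdivrMr// ler_pdivlMr// mulrC.
  rewrite !lebesgue_measure_itv/= !lte_fin ltrD2r ltr_pM2r ?invr_gt0//.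
  case: ifPn => ab; last by rewrite mule0.
  by rewrite -!EFinB -EFinM; congr EFin; field; exact: lt0r_neq0.
rewrite [in RHS](eq_measure_integral nu); last by move=> A mA _; exact: nuE.
rewrite ge0_integral_mscale//= ge0_integral_pushforward//.
by rewrite muleA -EFinM mulVf ?mul1e// lt0r_neq0.
Qed.

Lemma ge0_integral_lebesgue_rVS n (f : 'rV[R]_n.+1 -> \bar R) :
  measurable_fun [set: 'rV[R]_n.+1] f -> (forall x, (0 <= f x)%E) ->
  (\int[lebesgue_rV n.+1]_x f x =
   \int[lebesgue_measure]_a \int[lebesgue_rV n]_v f (cons_rV (a, v)))%E.
Proof.
move=> mf f0.
rewrite -(fubini_tonelli1 (fun p => f (cons_rV p))) //; last first.
  by apply: measurableT_comp => //; exact: measurable_cons_rV.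
rewrite -[RHS]/(\int[_]_(x in (@cons_rV R n) @^-1` setT) (f \o (@cons_rV R n)) x)%E.
by rewrite -ge0_integral_pushforward//; exact: measurable_cons_rV.
Qed.

Lemma measurable_affine_rV n (s : R) (c : 'rV[R]_n) :
  measurable_fun [set: 'rV[R]_n] (fun x => s *: (x - c)).
Proof.
apply: measurable_fun_coordP => i.
rewrite (_ : (fun _ => _) = (fun t : mR => s * (t - c ord0 i)) \o
  (fun x : 'rV[R]_n => x ord0 i : mR)).
  by apply: measurableT_comp; [exact: measurable_affine|exact: measurable_coord].
by apply/funext => x /=; rewrite !mxE.
Qed.

(** Induction on the dimension: Tonelli splits off the first coordinate, and each coordinate
    contributes one factor [s^-1]. *)
Lemma ge0_integral_affine_rV n (s : R) (c : 'rV[R]_n) (f : 'rV[R]_n -> \bar R) :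
  0 < s -> measurable_fun [set: 'rV[R]_n] f -> (forall x, (0 <= f x)%E) ->
  (\int[lebesgue_rV n]_x f (s *: (x - c))%R =
   (s ^- n)%:E * \int[lebesgue_rV n]_x f x)%E.
Proof.
move=> s0; elim: n c f => [|n IHn] c f mf f0.
  rewrite expr0 invr1 mul1e; apply: eq_integral => x _; congr f.
  by apply/rowP => -[].
have mfA : measurable_fun setT (fun x : 'rV[R]_n.+1 => f (s *: (x - c))).
  by apply: measurableT_comp => //; exact: measurable_affine_rV.
have mF : measurable_fun setT (fun p => f (cons_rV p)).
  by apply: measurableT_comp => //; exact: measurable_cons_rV.
rewrite !ge0_integral_lebesgue_rVS//.
pose c' := uncons_rV c.
transitivity (\int[lebesgue_measure]_a ((s ^- n)%:E *
    \int[lebesgue_rV n]_v f (cons_rV (s * (a - c'.1), v)%R)))%E.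
  apply: eq_integral => a _.
  rewrite -(IHn c'.2 (fun v => f (cons_rV (s * (a - c'.1), v))))//; last first.
    by apply: (measurableT_comp mF); exact: measurable_fun_pair.
  apply: eq_integral => v _; congr f; apply/rowP => i; rewrite !mxE.
  by case: (unliftP ord0 i) => [j ->|->] /=; rewrite ?liftK ?unlift_none/= ?mxE.
rewrite ge0_integralZl//; last 3 first.
- apply: measurableT_comp (measurable_fun_fubini_tonelli_F _ mF _) _ => //.
  exact: measurable_affine.
- by move=> a _; apply: integral_ge0.
- by rewrite lee_fin invr_ge0 exprn_ge0// ltW.
pose F := fubini_F (lebesgue_rV n) (fun p => f (cons_rV p)).
rewrite (ge0_integral_affine (f := F) c'.1 s0); last 2 first.
- exact: measurable_fun_fubini_tonelli_F.
- by move=> a; apply: integral_ge0.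
by rewrite muleA -EFinM -invfM exprS mulrC.
Qed.
End affine_change_of_variables.

(** * Affine maps on R^N x R: change of variables and Borel measurability *)

Section affine_product.
Context {R : realType} {N : nat}.
Local Notation mR := (measurableTypeR R).
Local Notation HT := ('rV[R]_N * mR)%type.

(** The vertical shift [y0] is 0 for rescalings; with [s = 1] the map is an arbitrary translation,
    as integrals along segments require. *)
Definition affine_map (s : R) (x0 : 'rV[R]_N) (y0 : R) (p : 'rV[R]_N * R) :
    'rV[R]_N * R :=
  (s *: (p.1 - x0), s * (p.2 - y0)).

Lemma measurable_affine_map s x0 y0 :
  measurable_fun [set: HT] (affine_map s x0 y0 : HT -> HT).
Proof.
apply: measurable_fun_pair.
  exact: (measurableT_comp (measurable_affine_rV s x0) measurable_fst).
exact: (measurableT_comp (measurable_affine s y0) measurable_snd).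
Qed.

Lemma ge0_integral_affine_map s x0 y0 (f : HT -> \bar R) : 0 < s ->
  measurable_fun [set: HT] f -> (forall p, (0 <= f p)%E) ->
  (\int[lebesgue_half]_p f (affine_map s x0 y0 p) =
   (s ^- N.+1)%:E * \int[lebesgue_half]_p f p)%E.
Proof.
move=> s0 mf f0; rewrite /lebesgue_half.
have mfA : measurable_fun [set: HT] (fun p => f (affine_map s x0 y0 p)).
  exact: (measurableT_comp mf (measurable_affine_map s x0 y0)).
rewrite !fubini_tonelli1//.
pose F := fubini_F lebesgue_measure f.
have mF : measurable_fun setT F by exact: measurable_fun_fubini_tonelli_F.
have F0 x : (0 <= F x)%E by exact: integral_ge0.
transitivity (\int[lebesgue_rV N]_x (s^-1%:E * F (s *: (x - x0))%R))%E.
  apply: eq_integral => x _.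
  rewrite -(ge0_integral_affine (f := fun y => f (s *: (x - x0), y)) y0 s0)//.
  exact: measurableT_comp.
rewrite ge0_integralZl//; last 2 first.
- by apply: (measurableT_comp mF); exact: measurable_affine_rV.
- by rewrite lee_fin invr_ge0 ltW.
by rewrite ge0_integral_affine_rV// muleA -EFinM exprS invfM.
Qed.

Lemma measurable_half_space : measurable (half_space : set HT).
Proof.
rewrite (_ : half_space = snd @^-1` [set` `]0, +oo[ : interval R]); last first.
  by apply/seteqP; split => p /=; rewrite in_itv/= andbT.
rewrite -[X in measurable X]setTI.
by apply: measurable_snd => //; exact: measurable_itv.
Qed.

(** With [s] positive and no vertical shift, the half-space is its own preimage, so the restriction
    commutes with the change of variables. *)
Lemma ge0_integral_affine_half_space s x0 (f : HT -> \bar R) : 0 < s ->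
  measurable_fun half_space f -> (forall p, half_space p -> (0 <= f p)%E) ->
  (\int[lebesgue_half]_(p in half_space) f (affine_map s x0 0 p) =
   (s ^- N.+1)%:E * \int[lebesgue_half]_(p in half_space) f p)%E.
Proof.
move=> s0 mf f0.
rewrite integral_mkcond [in RHS]integral_mkcond.
rewrite -(ge0_integral_affine_map x0 0 s0); last 2 first.
- apply/(measurable_restrictT _ measurable_half_space) => //.
- by apply: erestrict_ge0.
apply: eq_integral => p _; rewrite !patchE.
congr (if _ then _ else _); apply/idP/idP; rewrite !inE /half_space/= subr0.
  by move=> p0; rewrite mulr_gt0.
by rewrite pmulr_rgt0.
Qed.

Lemma lebesgue_half_affine_preimage0 s x0 y0 (A : set HT) : 0 < s ->
  measurable A -> lebesgue_half A = 0%E ->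
  lebesgue_half (affine_map s x0 y0 @^-1` A) = 0%E.
Proof.
move=> s0 mA A0.
have mB : measurable (affine_map s x0 y0 @^-1` A : set HT).
  by rewrite -[X in measurable X]setTI; exact: measurable_affine_map.
rewrite -(setIT (_ @^-1` _)) -integral_indic//=.
transitivity (\int[lebesgue_half]_p
   ((EFin \o (\1_A : HT -> R)) (affine_map s x0 y0 p)))%E => //.
rewrite ge0_integral_affine_map//; last 2 first.
  by apply/measurable_EFinP.
  by move=> p; rewrite lee_fin.
by rewrite integral_indic// setIT A0 mule0.
Qed.

Lemma ae_affine_map s x0 y0 (P : HT -> Prop) : 0 < s ->
  {ae lebesgue_half, forall p, P p} ->
  {ae lebesgue_half, forall p, P (affine_map s x0 y0 p)}.
Proof.
move=> s0 [A [mA A0 PA]]; exists (affine_map s x0 y0 @^-1` A); split.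
- by rewrite -[X in measurable X]setTI; exact: measurable_affine_map.
- exact: lebesgue_half_affine_preimage0.
- by move=> p /= Pp; exact: PA.
Qed.

(** The sigma-algebra is the one generated by the coordinates, so each open superlevel set is
    written as the union of the countably many rational boxes that it contains. *)
Lemma continuous_measurable_rV_prod (f : 'rV[R]_N * R -> R) :
  continuous f -> measurable_fun [set: HT] (f : HT -> R).
Proof.
move=> cf; apply: (measurability _ (RGenOInfty.measurableE R)) => //.
move=> /= _ [_ [a ->] <-]; rewrite setTI.
set U := f @^-1` _.
have oU : open U by apply: open_comp => // x _; exact: cf.
pose box (q : 'rV[rat]_N * rat * nat) : set HT :=
  [set p : HT | (forall i, ball (ratr (q.1.1 ord0 i) : R) q.2.+1%:R^-1 (p.1 ord0 i)) /\
           ball (ratr q.1.2 : R) q.2.+1%:R^-1 (p.2 : R)].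
have mbox q : measurable (box q).
  rewrite (_ : box q = (\bigcap_(i in [set: 'I_N]) ((fun p : HT => p.1 ord0 i) @^-1`
      ball (ratr (q.1.1 ord0 i) : R) q.2.+1%:R^-1)) `&`
      (snd @^-1` ball (ratr q.1.2 : R) q.2.+1%:R^-1)); last first.
    apply/seteqP; split => p /= [p1 p2]; split => //= i.
      by move=> _; exact: p1.
    exact: (p1 i I).
  apply: measurableI.
    apply: fin_bigcap_measurable => // i _.
    rewrite -[X in measurable X]setTI.
    apply: (measurableT_comp (measurable_coord i) measurable_fst) => //.
    exact: measurable_ball.
  rewrite -[X in measurable X]setTI.
  by apply: measurable_snd => //; exact: measurable_ball.
rewrite (_ : U = \bigcup_q (if `[< box q `<=` U >] then box q else set0)); last first.
  apply/seteqP; split => [p Up|p [q _]]; last by case: asboolP => // qU /qU.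
  have /nbhs_ballP[e /= e0 peU] : nbhs p U by apply: open_nbhs_nbhs.
  (* Half of [e], because [p] and a point [z] of the box are compared through the rational
     centre. *)
  have [k ke] : exists k : nat, k.+1%:R^-1 < e / 2.
    have : 0 < e / 2 by rewrite divr_gt0.
    by move=> /ltr_add_invr[k]; rewrite add0r => ke; exists k.
  have k0 : (0 : R) < k.+1%:R^-1 by rewrite invr_gt0.
  have rat_near (x : R) : exists q : rat, ball (ratr q : R) k.+1%:R^-1 x.
    have /rat_in_itvoo[q /itvP qP] : x - k.+1%:R^-1 < x + k.+1%:R^-1
      by rewrite ltrBlDr -addrA ltrDl addr_gt0.
    by exists q; rewrite -ball_normE/= ltr_distl !qP.
  pose q : 'rV[rat]_N * rat * nat :=
    (\row_i projT1 (cid (rat_near (p.1 ord0 i))), projT1 (cid (rat_near p.2)), k).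
  have pq : box q p.
    by split => /= [i|]; rewrite ?mxE; case: cid.
  exists q => //; have -> : `[< box q `<=` U >]; last by [].
  apply/asboolP => z [z1 z2]; apply: peU.
  have near2 (r b c : R) : ball r k.+1%:R^-1 b -> ball r k.+1%:R^-1 c -> ball b e c.
    move=> /ball_sym ab ac; apply: le_ball (ball_triangle ab ac).
    by rewrite [leRHS]splitr lerD// ltW.
  split => /=; last exact: near2 pq.2 z2.
  split => // i j; rewrite ord1; exact: near2 (pq.1 _) (z1 _).
apply: countable_bigcupT_measurable => // q; case: ifP => // _.
Qed.

End affine_product.

(** * Rescaling of test functions, gradients and traces *)

Section directional_derivatives.
Context {R : realType} {V : normedModType R}.
Implicit Types (f : V -> R) (p q v x : V) (s c : R).

(** The two difference quotients agree for every [h], so derivatives along a line and directional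
    derivatives are the same limits, with no differentiability involved. *)
Lemma line_quotientE f p v (t : R) :
  (fun h : R => h^-1 *: (((fun t : R => f (p + t *: v)) \o shift t) (h *: 1) -
                         f (p + t *: v))) =
  (fun h : R => h^-1 *: ((f \o shift (p + t *: v)) (h *: v) - f (p + t *: v))).
Proof.
apply/funext => h /=; rewrite [_%:A]mulr1.
by rewrite scalerDl addrCA.
Qed.

Lemma derivable_line f p v (t : R) : derivable f (p + t *: v) v ->
  derivable (fun t : R => f (p + t *: v)) t 1.
Proof. by rewrite /derivable line_quotientE. Qed.

Lemma derive1_line f p v (t : R) :
  (fun t : R => f (p + t *: v))^`()%classic t = 'D_v f (p + t *: v).
Proof. by rewrite derive1E /derive line_quotientE. Qed.

(** Chain rule for [t |-> f (x + t *: v)] after [t |-> s * t]; this covers [s = 0] as well. *)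
Lemma deriveZdir f x v s : derivable f x v -> 'D_(s *: v) f x = s * 'D_v f x.
Proof.
move=> df; pose g := fun t : R => f (x + t *: v).
have dg : derivable g (s * 0) 1.
  by apply: derivable_line; rewrite mulr0 scale0r addr0.
have ds : derivable ( *%R s) 0 (1 : R).
  by apply: derivableM; [exact: derivable_cst|exact: derivable_id].
have gE : (fun t : R => f (x + t *: (s *: v))) = g \o *%R s.
  by apply/funext => t /=; rewrite /g scalerA mulrC.
have := derive1_line f x (s *: v) 0.
rewrite gE (derive1_comp ds dg) derive1_line mulr0 !scale0r !addr0 => <-.
have dsE : 'D_1 ( *%R s) (0 : R) = s.
  have := @deriveMl R R id s 0 1 (@derivable_id R R 0 1).
  by rewrite derive_id mulr1.
by rewrite derive1E dsE mulrC.
Qed.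

Lemma affine_quotientE f q s v x :
  (fun h : R => h^-1 *: (((fun p => f (s *: (p - q))) \o shift x) (h *: v) -
                         f (s *: (x - q)))) =
  (fun h : R => h^-1 *: ((f \o shift (s *: (x - q))) (h *: (s *: v)) -
                         f (s *: (x - q)))).
Proof.
apply/funext => h /=; congr (_ *: (f _ - _)).
by rewrite -addrA scalerDr !scalerA mulrC.
Qed.

Lemma derivable_affine f q s v x : derivable f (s *: (x - q)) (s *: v) ->
  derivable (fun p => f (s *: (p - q))) x v.
Proof. by rewrite /derivable affine_quotientE. Qed.

Lemma derive_affine f q s v x :
  'D_v (fun p => f (s *: (p - q))) x = 'D_(s *: v) f (s *: (x - q)).
Proof. by rewrite /derive affine_quotientE. Qed.

Lemma continuous_affine q s : continuous (fun p => s *: (p - q)).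
Proof.
move=> x; apply: cvgZr.
by apply: cvgB; [exact: cvg_id|exact: cvg_cst].
Qed.

(** Keeping the chain-rule factor inside the direction, as the derivative along [s *: v], leaves the
    shape of the function unchanged, so the induction hypothesis applies directly. *)
Lemma Ck_affine k c q s f : Ck k f -> Ck k (fun p => c * f (s *: (p - q))).
Proof.
have contA g : continuous g -> continuous (fun p => c * g (s *: (p - q))).
  move=> cg x; apply: cvgM; first exact: cvg_cst.
  by apply: continuous_comp; [exact: continuous_affine|exact: cg].
elim: k f => [|k IHk] f /=; first exact: contA.
move=> [cf df Df]; split; first exact: contA.
  move=> x v; apply: derivableM; first exact: derivable_cst.
  by apply: derivable_affine; exact: df.
move=> v; rewrite (_ : (fun x => _) = (fun x => c * 'D_(s *: v) f (s *: (x - q)))).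
  exact: (IHk (fun x => 'D_(s *: v) f x) (Df _)).
apply/funext => x; rewrite -derive_affine deriveMl//.
by apply: derivable_affine; exact: df.
Qed.

End directional_derivatives.

(** The factor in [rescale]. Its square offsets weight, chain rule and Jacobian in the energy; its
    power of order [critical_exponent] offsets the Jacobian on R^N. *)
Definition amplitude (R : realType) (N : nat) (alpha s : R) : R :=
  s `^ ((N%:R - 2 * alpha) / 2).

(** * Behaviour of the energy and of the L^2 norm under rescaling *)

Section test_functions.
Context {R : realType} {N : nat}.
Local Notation mR := (measurableTypeR R).
Local Notation HT := ('rV[R]_N * mR)%type.
Implicit Types (phi psi w : 'rV[R]_N * R -> R) (alpha s : R).
Implicit Types (G : 'rV[R]_N * R -> 'rV[R]_N * R).

Lemma CkB (V : normedModType R) k (f g : V -> R) :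
  Ck k f -> Ck k g -> Ck k (fun p => f p - g p).
Proof.
elim: k f g => [|k IHk] f g /=.
  by move=> cf cg x; apply: cvgB; [exact: cf|exact: cg].
move=> [cf df Df] [cg dg Dg]; split.
- by move=> x; apply: cvgB; [exact: cf|exact: cg].
- by move=> x v; apply: derivableB.
- move=> v; rewrite (_ : (fun x => _) = (fun x => 'D_v f x - 'D_v g x)).
    exact: IHk.
  by apply/funext => x; rewrite -deriveB.
Qed.

Lemma gradientB phi psi p : Ck 1 phi -> Ck 1 psi ->
  gradient (fun p => phi p - psi p) p = gradient phi p - gradient psi p.
Proof.
move=> [_ dphi _] [_ dpsi _]; rewrite /gradient; congr pair; last exact: deriveB.
by apply/rowP => i; rewrite !mxE; exact: deriveB.
Qed.

Lemma measurable_gradient phi : Ck 1 phi ->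
  measurable_fun [set: HT] (gradient phi : HT -> HT).
Proof.
move=> [_ _ Dphi]; apply: measurable_fun_pair; last first.
  by apply: continuous_measurable_rV_prod; exact: Dphi.
apply: measurable_fun_coordP => i.
rewrite (_ : (fun _ => _) = 'D_(delta_mx 0 i, 0) phi); last first.
  by apply/funext => p; rewrite mxE.
by apply: continuous_measurable_rV_prod; exact: Dphi.
Qed.

Lemma measurable_vectorB (G1 G2 : HT -> HT) :
  measurable_fun setT G1 -> measurable_fun setT G2 ->
  measurable_fun [set: HT] ((fun p => (G1 p : 'rV[R]_N * R) - G2 p) : HT -> HT).
Proof.
move=> mG1 mG2; apply: measurable_fun_pair; last first.
  by apply: measurable_funB; exact: (measurableT_comp measurable_snd).
apply: measurable_fun_coordP => i.
rewrite (_ : (fun _ => _) =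
    (fun p => (G1 p).1 ord0 i) \- (fun p => (G2 p).1 ord0 i)); last first.
  by apply/funext => p; rewrite !mxE.
by apply: measurable_funB; apply: (measurableT_comp (measurable_coord i));
  exact: (measurableT_comp measurable_fst).
Qed.

Lemma measurable_sq_euclid (G : HT -> HT) : measurable_fun setT G ->
  measurable_fun [set: HT] (fun p => sq_euclid (G p)).
Proof.
move=> mG; apply: measurable_funD.
  apply: measurable_sum => i; apply: measurable_funX.
  apply: (measurableT_comp (measurable_coord i)).
  exact: measurableT_comp mG.
by apply: measurable_funX; exact: measurableT_comp mG.
Qed.

Lemma measurable_energy_density alpha (G : HT -> HT) : measurable_fun setT G ->
  measurable_fun [set: HT]
    (fun p => (p.2 `^ (1 - 2 * alpha) * sq_euclid (G p))%:E).
Proof.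
move=> mG; apply/measurable_EFinP; apply: measurable_funM.
  exact: (measurableT_comp (measurable_powR _) measurable_snd).
exact: measurable_sq_euclid.
Qed.

Lemma sq_euclid_ge0 (v : 'rV[R]_N * R) : 0 <= sq_euclid v.
Proof. by rewrite addr_ge0 ?sqr_ge0// sumr_ge0// => i _; rewrite sqr_ge0. Qed.

Lemma sq_euclidZ (k : R) (v : 'rV[R]_N * R) :
  sq_euclid (k *: v) = k ^+ 2 * sq_euclid v.
Proof.
rewrite /sq_euclid mulrDr mulr_sumr /= exprMn; congr (_ + _).
by apply: eq_bigr => i _; rewrite mxE exprMn.
Qed.

Lemma affine_mapE s x0 y0 (p : 'rV[R]_N * R) :
  affine_map s x0 y0 p = s *: (p - (x0, y0)).
Proof. by []. Qed.

Lemma rescaleE alpha s x0 w : rescale alpha s x0 w =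
  (fun p => amplitude N alpha s * w (s *: (p - (x0, 0)))).
Proof. by apply/funext => p; rewrite -affine_mapE /affine_map subr0. Qed.

Lemma gradient_rescale alpha s x0 phi : Ck 1 phi ->
  gradient (rescale alpha s x0 phi) =
  (fun p => (amplitude N alpha s * s) *: gradient phi (affine_map s x0 0 p)).
Proof.
move=> [_ dphi _].
have DE v p : 'D_v (rescale alpha s x0 phi) p =
    amplitude N alpha s * s * 'D_v phi (affine_map s x0 0 p).
  rewrite rescaleE deriveMl ?derive_affine ?deriveZdir ?mulrA//.
  exact: derivable_affine.
apply/funext => p; rewrite /gradient; congr pair; last exact: DE.
by apply/rowP => i; rewrite !mxE DE.
Qed.

(** The powers of [s] are [-(1 - 2 alpha)] from the weight, [N - 2 alpha] from the squared
    amplitude, 2 from the squared chain-rule factor and [-(N + 1)] from the Jacobian; their sum is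
    0. An arbitrary field [G] is allowed so that the difference of a gradient and its limit is
    covered. *)
Lemma energy_rescale alpha s x0 G : 0 < s ->
  measurable_fun setT (G : HT -> HT) ->
  energy alpha (fun p => (amplitude N alpha s * s) *: G (affine_map s x0 0 p)) =
  energy alpha G.
Proof.
move=> s0 mG; rewrite /energy.
set a := 1 - 2 * alpha.
pose h p := (p.2 `^ a * sq_euclid (G p))%:E.
pose k := s `^ (- a) * (amplitude N alpha s * s) ^+ 2.
transitivity (\int[lebesgue_half]_(p in half_space) 
    (k%:E * h (affine_map s x0 0 p)))%E.
  apply: eq_integral => p; rewrite inE => p0; rewrite /h -EFinM; congr EFin.
  rewrite sq_euclidZ /k /= subr0 powRM ?(ltW s0) ?(ltW p0)//.
  rewrite [RHS](_ : _ = (s `^ (- a) * s `^ a) * (p.2 `^ a * ((amplitude N alpha s * s) ^+ 2 *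
    sq_euclid (G (affine_map s x0 0 p))))); last by rewrite /=; ring.
  by rewrite -powRD ?addNr ?powRr0 ?mul1r//; apply/implyP => _; rewrite lt0r_neq0.
have h0 p : (0 <= h p)%E by rewrite lee_fin mulr_ge0 ?powR_ge0 ?sq_euclid_ge0.
have mh : measurable_fun setT (h : HT -> _) by exact: measurable_energy_density.
rewrite ge0_integralZl//; last 3 first.
- exact: measurable_half_space.
- apply: measurable_funTS.
  exact: (measurableT_comp mh (measurable_affine_map s x0 0)).
- by rewrite lee_fin mulr_ge0 ?powR_ge0 ?sqr_ge0.
rewrite ge0_integral_affine_half_space//; last exact: measurable_funTS.
rewrite muleA -EFinM (_ : k * _ = 1) ?mul1e//.
rewrite /k exprMn /amplitude -[(_ `^ _) ^+ 2]powR_mulrn ?powR_ge0//.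
rewrite -[s ^+ 2]powR_mulrn ?(ltW s0)// -[s ^+ N.+1]powR_mulrn ?(ltW s0)//.
rewrite -powRN -powRrM -!powRD; do ?[by apply/implyP => _; rewrite lt0r_neq0].
by rewrite [X in _ `^ X](_ : _ = 0) ?powRr0// /a -natr1; field.
Qed.

Lemma ge0_energy alpha G : (0 <= energy alpha G)%E.
Proof.
by apply: integral_ge0 => p _; rewrite lee_fin mulr_ge0 ?powR_ge0 ?sq_euclid_ge0.
Qed.

Lemma ge0_sq_L2 (u : 'rV[R]_N -> R) : (0 <= sq_L2 u)%E.
Proof. by apply: integral_ge0 => x _; rewrite lee_fin sqr_ge0. Qed.

(** The exponent is [N - 2 alpha] from the squared amplitude minus [N] from the Jacobian. The L^2
    part of the norm thus changes by a fixed factor only, which preserves Cauchy sequences and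
    limits. *)
Lemma sq_L2_rescale alpha s x0 (u : 'rV[R]_N -> R) : 0 < s ->
  measurable_fun setT (u : 'rV[R]_N -> mR) ->
  (sq_L2 (fun x => amplitude N alpha s * u (s *: (x - x0)))%R =
  (s `^ (- (2 * alpha)))%:E * sq_L2 u)%E.
Proof.
move=> s0 mu; rewrite /sq_L2.
have mu2 : measurable_fun setT (fun x => (u x ^+ 2)%:E).
  by apply/measurable_EFinP; apply: measurable_funX.
under eq_integral do rewrite exprMn EFinM.
rewrite ge0_integralZl//; last 3 first.
- exact: (measurableT_comp mu2 (measurable_affine_rV s x0)).
- by move=> x _; rewrite lee_fin sqr_ge0.
- by rewrite lee_fin sqr_ge0.
rewrite (ge0_integral_affine_rV x0 s0 mu2); last first.
  by move=> x; rewrite lee_fin sqr_ge0.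
rewrite muleA -EFinM; congr (_%:E * _)%E.
rewrite /amplitude -[(_ `^ _) ^+ 2]powR_mulrn ?powR_ge0//.
rewrite -[s ^+ N]powR_mulrn ?(ltW s0)// -powRN -powRrM -powRD.
  by congr (_ `^ _); field.
by apply/implyP => _; rewrite lt0r_neq0.
Qed.

End test_functions.

(** * Rescaling of representing sequences, gradients and traces *)

Section rescaling.
Context {R : realType} {N : nat}.
Local Notation mR := (measurableTypeR R).
Local Notation HT := ('rV[R]_N * mR)%type.
Implicit Types (phi w : 'rV[R]_N * R -> R) (alpha s : R).
Implicit Types (G : 'rV[R]_N * R -> 'rV[R]_N * R) (u : 'rV[R]_N -> R).

Lemma amplitude_gt0 alpha s : 0 < s -> 0 < amplitude N alpha s.
Proof. by move=> s0; exact: powR_gt0. Qed.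

Lemma rescaleB alpha s (x0 : 'rV[R]_N) phi w :
  (fun p => rescale alpha s x0 phi p - rescale alpha s x0 w p) =
  rescale alpha s x0 (fun p => phi p - w p).
Proof. by apply/funext => p; rewrite /rescale mulrBr. Qed.

(** Solving [z = s *: (x - x0)] for [x] gives [s^-1 *: (z - c)] with [c = - (s *: x0)], hence the
    new centre. This turns every transport statement into an equivalence. *)
Lemma rescaleV alpha s (x0 : 'rV[R]_N) w : 0 < s ->
  rescale alpha s^-1 (- (s *: x0)) (rescale alpha s x0 w) = w.
Proof.
move=> s0; have s_neq0 : s != 0 by rewrite lt0r_neq0.
apply/funext => -[x y]; rewrite /rescale /= mulrA -powRM ?invr_ge0 ?(ltW s0)//.
rewrite mulVf// powR1 mul1r opprK mulrA mulfV// mul1r; congr (w (_, _)).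
by rewrite scalerBr scalerA mulfV// scale1r addrK.
Qed.

Lemma test_function_Ck k phi : test_function phi -> Ck k phi.
Proof. by case. Qed.

Lemma test_function_rescale alpha s (x0 : 'rV[R]_N) phi : 0 < s ->
  test_function phi -> test_function (rescale alpha s x0 phi).
Proof.
move=> s0 [Cphi cphi]; rewrite rescaleE; split=> [k|]; first exact: Ck_affine.
set q : 'rV[R]_N * R := (x0, 0).
have s_neq0 : s != 0 by rewrite lt0r_neq0.
(* [B] inverts [p |-> s *: (p - q)], so the support of the rescaled function lies in the compact
   image under [B] of the support of [phi]. *)
pose B (p : 'rV[R]_N * R) := s^-1 *: (p - (- (s *: q))).
have cB : compact (B @` closure [set p | phi p != 0]).
  apply: continuous_compact => //; apply: continuous_subspaceT.
  exact: continuous_affine.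
apply: (subclosed_compact _ cB); first exact: closed_closure.
rewrite closureE; apply: smallest_sub.
  by apply: compact_closed => //; exact: norm_hausdorff.
move=> p /=; rewrite mulf_eq0 negb_or => /andP[_ phip].
exists (s *: (p - q)); first exact: subset_closure.
by rewrite /B opprK scalerBr subrK scalerA mulVf// scale1r.
Qed.

Lemma measurable_restrict0 phi : continuous phi ->
  measurable_fun [set: 'rV[R]_N] (restrict0 phi : _ -> mR).
Proof.
move=> cphi; apply: (measurableT_comp (continuous_measurable_rV_prod cphi)).
by apply: measurable_fun_pair.
Qed.

Lemma restrict0_rescale alpha s (x0 : 'rV[R]_N) phi :
  restrict0 (rescale alpha s x0 phi) =
  (fun x => amplitude N alpha s * restrict0 phi (s *: (x - x0))).
Proof. by apply/funext => x; rewrite /restrict0 /rescale /= mulr0. Qed.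

Lemma sq_Xnorm_rescale alpha s (x0 : 'rV[R]_N) phi : 0 < s -> Ck 1 phi ->
  (sq_Xnorm alpha (rescale alpha s x0 phi) = energy alpha (gradient phi) +
     (s `^ (- (2 * alpha)))%:E * sq_L2 (restrict0 phi))%E.
Proof.
move=> s0 Cphi; rewrite /sq_Xnorm gradient_rescale// energy_rescale//; last first.
  exact: measurable_gradient.
rewrite restrict0_rescale sq_L2_rescale//.
by apply: measurable_restrict0; case: Cphi.
Qed.

Lemma represents_rescale alpha s (x0 : 'rV[R]_N) f w : 0 < s ->
  represents alpha f w ->
  represents alpha (fun n => rescale alpha s x0 (f n)) (rescale alpha s x0 w).
Proof.
move=> s0 [tf cf fw]; split.
- by move=> n; exact: test_function_rescale.
(* The energy is kept and the L^2 part is multiplied by a power of [s], so the squared norm grows at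
   most by [K]; since [X_cauchy] compares with [e ^+ 2], the tolerance is divided by the square root
   of [K]. *)
- move=> e e0; pose K := Num.max 1 (s `^ (- (2 * alpha))).
  have K1 : 1 <= K by rewrite le_max lexx.
  have K0 : 0 < K by exact: lt_le_trans K1.
  have e'0 : 0 < e / Num.sqrt K by rewrite divr_gt0// sqrtr_gt0.
  have [n0 Hn0] := cf _ e'0; exists n0 => m n nm nn.
  rewrite rescaleB sq_Xnorm_rescale//; last by apply: CkB; exact: test_function_Ck.
  set phi := fun p => _ - _.
  apply: (@le_lt_trans _ _ (K%:E * sq_Xnorm alpha phi)%E).
    rewrite /sq_Xnorm [leRHS]ge0_muleDr ?ge0_energy ?ge0_sq_L2//.
    apply: leeD.
      by rewrite -[leLHS]mul1e lee_pmul ?ge0_energy ?lee_fin.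
    by rewrite lee_pmul ?ge0_sq_L2 ?lee_fin ?powR_ge0// le_max lexx orbT.
  rewrite (_ : e ^+ 2 = K * (e / Num.sqrt K) ^+ 2); last first.
    by rewrite expr_div_n sqr_sqrtr ?(ltW K0)//; field; rewrite lt0r_neq0.
  rewrite EFinM lte_pmul2l//.
  exact: Hn0.
- have := ae_affine_map x0 0 s0 fw; apply: filterS => [|p fp p0].
    exact: (ae_filter_ringOfSetsType lebesgue_half).
  rewrite rescaleE; under eq_fun do rewrite rescaleE.
  apply: cvgM; first exact: cvg_cst.
  by rewrite -affine_mapE; apply: fp; rewrite /half_space/= subr0 mulr_gt0.
Qed.

(** By [energy_rescale] the rescaled gradients are at exactly the same distance from the rescaled
    limit. *)
Lemma is_Xgradient_rescale alpha s (x0 : 'rV[R]_N) w G : 0 < s ->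
  is_Xgradient alpha w G ->
  is_Xgradient alpha (rescale alpha s x0 w)
    (fun p => (amplitude N alpha s * s) *: G (affine_map s x0 0 p)).
Proof.
move=> s0 [mG [f fw fG]]; split.
  have mGA := measurableT_comp mG (measurable_affine_map s x0 0).
  apply: measurable_fun_pair.
    apply: measurable_fun_coordP => i.
    rewrite (_ : (fun _ => _) = (fun p => amplitude N alpha s * s *
        (G (affine_map s x0 0 p)).1 ord0 i)).
      apply: measurable_funM => //.
      apply: (measurableT_comp (measurable_coord i)).
      exact: (measurableT_comp measurable_fst mGA).
    by apply/funext => p; rewrite mxE.
  by apply: measurable_funM => //; exact: (measurableT_comp measurable_snd mGA).
exists (fun n => rescale alpha s x0 (f n)); first exact: represents_rescale.
apply: cvg_trans fG; apply: near_eq_cvg; apply: nearW => n.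
have C1 : Ck 1 (f n) by apply: test_function_Ck; case: fw.
rewrite -(energy_rescale alpha x0 s0 (G := fun p => gradient (f n) p - G p)).
  by congr energy; apply/funext => p; rewrite gradient_rescale// scalerBr.
by apply: measurable_vectorB => //; exact: measurable_gradient.
Qed.

Lemma is_Xtrace_rescale alpha s (x0 : 'rV[R]_N) w u : 0 < s ->
  is_Xtrace alpha w u ->
  is_Xtrace alpha (rescale alpha s x0 w)
    (fun x => amplitude N alpha s * u (s *: (x - x0))).
Proof.
move=> s0 [mu [f fw fu]]; split.
  apply: measurable_funM => //.
  exact: (measurableT_comp mu (measurable_affine_rV s x0)).
exists (fun n => rescale alpha s x0 (f n)); first exact: represents_rescale.
rewrite (_ : (fun n => _) = (fun n => (s `^ (- (2 * alpha)))%:E *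
    sq_L2 (fun x => restrict0 (f n) x - u x)%R)%E); last first.
  apply/funext => n; rewrite restrict0_rescale -(sq_L2_rescale alpha x0 s0).
    by congr sq_L2; apply/funext => x; rewrite mulrBr.
  apply: measurable_funB => //; apply: measurable_restrict0.
  by have [/(_ n)[/(_ 0)]] := fw.
rewrite -(mule0 (s `^ (- (2 * alpha)))%:E).
by apply: cvgeZl.
Qed.

End rescaling.

(** * Limits along lines *)

Lemma measurable_fun_limn_einf d (T : measurableType d) (R : realType)
    (D : set T) (f : (T -> \bar R)^nat) : (forall n, measurable_fun D (f n)) ->
  measurable_fun D (fun x => limn_einf (f ^~ x)).
Proof.
move=> mf; rewrite (_ : (fun _ => _) =
    (fun x => - limn_esup ((fun n x => - f n x) ^~ x))%E); last first.
  by apply/funext => x; rewrite -limn_einfN; congr limn_einf; apply/funext => n /=;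
    rewrite oppeK.
apply: measurableT_comp => //; apply: measurable_fun_limn_esup => n.
exact: measurableT_comp.
Qed.

Section line.
Context {R : realType}.
Local Notation mR := (measurableTypeR R).
Local Notation mu := (@lebesgue_measure R).

(** The tail infima increase to the lower limit, so each of them lies below [e]. *)
Lemma frequently_lt_limn_einf (u : (\bar R)^nat) (e : \bar R) n0 :
  (limn_einf u < e)%E -> exists2 n, (n0 <= n)%N & (u n < e)%E.
Proof.
move=> ue; have : (einfs u n0 < e)%E.
  apply: le_lt_trans ue; rewrite limn_einf_lim.
  by rewrite (cvg_lim _ (@cvg_einfs_sup _ u))//; apply: ereal_sup_ubound; exists n0.
by move=> /ereal_inf_lt[_ [n /= n0n <-] une]; exists n.
Qed.

Lemma limn_einf_ge0 (u : (\bar R)^nat) :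
  (forall n, (0 <= u n)%E) -> (0 <= limn_einf u)%E.
Proof.
move=> u0; rewrite limn_einf_lim; apply: lime_ge; first exact: is_cvg_einfs.
by apply: nearW => n; apply: le_ereal_inf_tmp => _ [k _ <-].
Qed.

Lemma limn_einf_le_cvg (u v : (\bar R)^nat) (l : \bar R) :
  (forall n, (u n <= v n)%E) -> v @ \oo --> l -> (limn_einf u <= l)%E.
Proof.
move=> uv vl; rewrite -(cvg_lim _ vl)// -is_cvg_limn_einfE; last by apply/cvg_ex; exists l.
rewrite !limn_einf_lim; apply: lee_lim; [exact: is_cvg_einfs|exact: is_cvg_einfs|].
apply: nearW => n; apply: le_ereal_inf_tmp => _ [k /= nk <-].
by apply: le_trans (uv k); apply: ereal_inf_lbound; exists k.
Qed.

Lemma integral_derive1_itv (g : R -> R) a b : a < b ->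
  (forall t, derivable g t 1) -> continuous g^`()%classic ->
  (\int[mu]_(t in `[a, b]) (g^`()%classic t)%:E = (g b - g a)%:E)%E.
Proof.
move=> ab dg cg; rewrite EFinB; apply: continuous_FTC2 => //.
  exact: continuous_subspaceT.
have cgg t : {for t, continuous g}.
  by apply/differentiable_continuous; rewrite -derivable1_diffP.
split => //; [apply: cvg_at_right_filter|apply: cvg_at_left_filter]; exact: cgg.
Qed.

Lemma not_negligible_itvoo (a b : R) (A : set mR) : a < b ->
  mu.-negligible A -> ~ ([set` `]a, b[] `<=` A).
Proof.
move=> ab [B [mB B0 AB]] abA.
have : (mu [set` `]a, b[] <= mu B)%E.
  by apply: le_measure; rewrite ?inE//; exact: subset_trans AB.
rewrite B0 lebesgue_measure_itv/= lte_fin ab -EFinB lee_fin => /le_lt_trans.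
by move=> /(_ (b - a)); rewrite subr_gt0 ltxx => /(_ ab).
Qed.

(** Lebesgue differentiation: the primitive [F] has derivative [k] almost everywhere. At a zero [s]
    of [F] with nonzero derivative, [F] would have no zero in a punctured neighbourhood of [s],
    whereas its zeros fill almost all of []0, 1[]. *)
Lemma ae_eq0_primitive (k : R -> R) :
  mu.-integrable `[0, 1] (EFin \o k) ->
  {ae mu, forall s, s \in `]0, 1[ -> \int[mu]_(t in `[0, s]) k t = 0} ->
  {ae mu, forall s, s \in `]0, 1[ -> k s = 0}.
Proof.
move=> ik Z.
(* Extension by 0 makes the function integrable on the whole line, as [FTC1] expects. *)
pose f := k \_ `[0, 1].
have lf : locally_integrable setT f by exact: integrable_locally.
have intf : mu.-integrable setT (EFin \o f).
  rewrite /f -restrict_EFin; apply/integrable_restrict => //=.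
  by rewrite setTI.
have intfy y : mu.-integrable [set` Interval (BLeft 0) (BRight y)] (EFin \o f).
  exact: (integrableS _ _ _ intf).
have := FTC1 intfy lf; set F := (fun x : R => \int[mu]_(t in _) f t) => FTC.
have FE s : s \in `]0, 1[ -> F s = \int[mu]_(t in `[0, s]) k t.
  rewrite in_itv/= => /andP[s0 s1]; apply: eq_Rintegral => t.
  rewrite inE/= in_itv/= => /andP[t0 ts]; rewrite /f patchE mem_set//=.
  by rewrite in_itv/= t0 (le_trans ts)// ltW.
have aeF : Filter (nbhs (almost_everywhere mu)) := ae_filter_ringOfSetsType mu.
apply: filterS2 (Z) FTC => s Zs + s01.
have /andP[s0 s1] : 0 < s < 1 by rewrite in_itv in s01.
move=> [|dF F'].
  by rewrite /= lte_fin.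
have -> : k s = f s by rewrite /f patchE mem_set//= in_itv/= !ltW.
rewrite -F'; apply/eqP/negP => /negP F's0.
have Fs0 : F s = 0 by rewrite FE// Zs.
have cF : (fun h => h^-1 *: (F (h *: 1 + s) - F s)) @ 0^' --> F^`()%classic s.
  by rewrite derive1E; exact: dF.
have : \forall h \near 0^', h^-1 *: (F (h *: 1 + s) - F s) != 0 :> R.
  exact: (cvgr_neq0 _ cF F's0).
rewrite Fs0 -nbhs_nearE => /nbhs_ballP[e /= e0 He].
have sb : s < Num.min (s + e) 1 by rewrite lt_min s1 ltrDl e0.
apply: (not_negligible_itvoo sb Z) => t /=.
rewrite in_itv/= lt_min => /and3P[st tse t1] Zt.
have t01 : t \in `]0, 1[ by rewrite in_itv/= t1 (lt_trans s0).
have := He (t - s); rewrite -ball_normE/= sub0r opprB distrC gtr0_norm ?subr_gt0//.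
rewrite ltrBlDl => /(_ tse); rewrite subr_eq0 gt_eqF// => /(_ isT).
by rewrite [_%:A]mulr1 subrK subr0 FE// Zt// scaler0 eqxx.
Qed.

(** The integral of [k] over [[0, s]] is close to [g n s - g n 0], which tends to 0, so the
    primitive of [k] vanishes at almost every [s]. Closeness of derivatives is asked only for
    arbitrarily large [n], which is what Fatou provides. *)
Lemma line_limit_eq0 (g : nat -> R -> R) (k : mR -> R) :
  (forall n t, derivable (g n) t 1) ->
  (forall n, continuous (g n)^`()%classic) ->
  measurable_fun setT k ->
  (forall e, 0 < e -> forall n0, exists2 n, (n0 <= n)%N &
    (\int[mu]_(t in `[0%R, 1%R]) ((((g n)^`()%classic t - k t) ^+ 2)%R%:E) < e%:E)%E) ->
  g n 0 @[n --> \oo] --> 0 ->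
  {ae mu, forall s, s \in `]0, 1[ -> g n s @[n --> \oo] --> 0} ->
  {ae mu, forall s, s \in `]0, 1[ -> k s = 0}.
Proof.
move=> dg cg mk gk g0 gs.
have mg n : measurable_fun setT ((g n)^`()%classic : mR -> R).
  exact: continuous_measurable_fun.
have msub n : measurable_fun [set: mR] (fun t => (g n)^`()%classic t - k t).
  exact: measurable_funB.
(* AM-GM in place of the Cauchy-Schwarz inequality *)
have L1 n (d : R) : 0 < d ->
    (\int[mu]_(t in `[0%R, 1%R]) (((g n)^`()%classic t - k t) ^+ 2)%:E < (d ^+ 2)%:E)%E ->
    (\int[mu]_(t in `[0%R, 1%R]) `|((g n)^`()%classic t - k t)%:E| < d%:E)%E.
  move=> d0 L2.
  apply: (@le_lt_trans _ _ (\int[mu]_(t in `[0%R, 1%R])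
     ((d / 2)%:E + (d^-1 / 2)%:E * (((g n)^`()%classic t - k t) ^+ 2)%R%:E))%E).
    apply: ge0_le_integral => //.
    - by apply/measurable_EFinP/measurable_funTS; exact: measurableT_comp.
    - apply/measurable_EFinP/measurable_funTS.
      by apply: measurable_funD => //; apply: measurable_funM => //; exact: measurable_funX.
    - move=> t _; rewrite -EFinM -EFinD lee_fin; set x := _ - _.
      have := sqr_ge0 (`|x| - d); rewrite sqrrB real_normK ?num_real// => x0.
      rewrite -(ler_pM2l d0) mulrDr !mulrA mulfV ?lt0r_neq0// mul1r.
      by lra.
  rewrite ge0_integralD//; last 3 first.
  - by move=> t _; rewrite lee_fin divr_ge0// ltW.
  - by move=> t _; rewrite -EFinM lee_fin mulr_ge0 ?sqr_ge0 ?divr_ge0// ?invr_ge0 ltW.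
  - apply/measurable_EFinP/measurable_funTS.
    by apply: measurable_funM => //; exact: measurable_funX.
  rewrite integral_cst//= lebesgue_measure_itv/= lte_fin ltr01 oppr0 adde0 mule1.
  rewrite ge0_integralZl//; last 3 first.
  - by apply/measurable_EFinP/measurable_funTS; exact: measurable_funX.
  - by move=> t _; rewrite lee_fin sqr_ge0.
  - by rewrite lee_fin divr_ge0// invr_ge0 ltW.
  rewrite (_ : d%:E = (d / 2)%:E + (d^-1 / 2)%:E * (d ^+ 2)%:E)%E; last first.
    by rewrite -EFinM -EFinD; congr EFin; field; rewrite lt0r_neq0.
  rewrite lteD2lE// lte_pmul2l// lte_fin divr_gt0// invr_gt0//.
have ig n : mu.-integrable `[0, 1] (EFin \o (g n)^`()%classic).
  apply: continuous_compact_integrable; first exact: segment_compact.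
  exact: continuous_subspaceT.
have ik : mu.-integrable `[0, 1] (EFin \o k).
  (* Accuracy 1 is enough: [k] then differs from a continuous derivative by an integrable
     function. *)
  have [n _ L2n] := gk 1 ltr01 0.
  have n1 := L1 n 1 ltr01; rewrite expr1n in n1; have {L2n} n1 := n1 L2n.
  have i1 : mu.-integrable `[0, 1] (EFin \o (fun t => (g n)^`()%classic t - k t)).
    apply/integrableP; split; first exact/measurable_EFinP/measurable_funTS.
    by rewrite (lt_trans n1) ?ltry.
  apply: eq_integrable (integrableB _ (ig n) i1) => // t _ /=.
  by rewrite -EFinB opprB addrC subrK.
apply: ae_eq0_primitive => //.
have aeF : Filter (nbhs (almost_everywhere mu)) := ae_filter_ringOfSetsType mu.
apply: filterS gs => s gs s01; have := s01; rewrite in_itv/= => /andP[s0 s1].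
have s01S : `[0, s] `<=` `[0, 1] by apply: subset_itvl; rewrite bnd_simp ltW.
have sub_int (h : mR -> R) : mu.-integrable `[0, 1] (EFin \o h) ->
    mu.-integrable `[0, s] (EFin \o h) by exact: integrableS.
rewrite /Rintegral; set I := (\int[_]_(t in _) _)%E.
have Ifin : I \is a fin_num by apply: integrable_fin_num => //; exact: sub_int.
apply/eqP; rewrite -normr_le0; apply/ler_addgt0Pr => e e0; rewrite add0r.
have e20 : 0 < e / 2 by rewrite divr_gt0.
have e20' : 0 < (e / 2) ^+ 2 by rewrite exprn_gt0.
have g0s : g n s - g n 0 @[n --> \oo] --> 0.
  by rewrite -[X in _ --> X](subr0 (0 : R)); apply: cvgB => //; exact: gs.
(* From [n0] on, the increment of [g n] over [[0, s]] is below [e / 2]; some such [n] also has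
   squared L^2 error below [(e / 2) ^+ 2], hence L^1 error below [e / 2]. *)
have /cvgrPdist_lt/(_ _ e20)[n0 _ Hn0] := g0s.
have [n n0n /(L1 _ _ e20) L1n] := gk _ e20' n0.
have := Hn0 n n0n; rewrite sub0r normrN => gne.
rewrite -lee_fin -abse_EFin fineK//.
have -> : I = ((g n s - g n 0)%:E - \int[mu]_(t in `[0%R, s]) ((g n)^`()%classic t - k t)%:E)%E.
  rewrite -integral_derive1_itv// -integralB_EFin//; last 2 first.
  - exact: sub_int.
  - apply: (sub_int (fun t => (g n)^`()%classic t - k t)).
    by apply: eq_integrable (integrableB _ (ig n) ik).
  apply: eq_integral => t _; by rewrite -EFinB opprB addrC subrK.
apply: le_trans (lee_abs_sub _ _) _.
have -> : e%:E = ((e / 2)%:E + (e / 2)%:E)%E by rewrite -EFinD -splitr.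
apply: leeD; first by rewrite abse_EFin lee_fin ltW.
apply: le_trans (ltW L1n).
apply: le_trans (le_abse_integral _ _ _) _ => //.
  by apply/measurable_EFinP/measurable_funTS.
apply: ge0_subset_integral => //.
by apply/measurable_EFinP/measurable_funTS; exact: measurableT_comp.
Qed.
End line.

(** * Integrals along segments *)

Section line_integral.
Context {R : realType} {N : nat}.
Local Notation mR := (measurableTypeR R).
Local Notation HT := ('rV[R]_N * mR)%type.
Local Notation mu := (@lebesgue_measure R).
Implicit Types (e : 'rV[R]_N * R) (F : HT -> \bar R) (d : R).

Definition line_integral e d F (p : HT) : \bar R :=
  (\int[mu]_(s in `[0%R, d]) F ((p : 'rV[R]_N * R) + s *: e)%R)%E.

Lemma measurable_line e : measurable_fun [set: (HT * mR)%type]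
  (fun q : HT * mR => (q.1 : 'rV[R]_N * R) + (q.2 : R) *: e : HT).
Proof.
apply: measurable_fun_pair; last first.
  apply: measurable_funD.
    exact: (measurableT_comp measurable_snd measurable_fst).
  by apply: measurable_funM => //; exact: measurable_snd.
apply: measurable_fun_coordP => i.
rewrite (_ : (fun _ => _) =
  (fun q : HT * mR => q.1.1 ord0 i) \+ (fun q : HT * mR => q.2 * e.1 ord0 i)).
  apply: measurable_funD.
    apply: (measurableT_comp (measurable_coord i)).
    exact: (measurableT_comp measurable_fst measurable_fst).
  by apply: measurable_funM => //; exact: measurable_snd.
by apply/funext => q; rewrite !mxE.
Qed.

Lemma measurable_along_line (disp : measure_display) (T : measurableType disp) e (F : HT -> T) p :
  measurable_fun setT F ->
  measurable_fun [set: mR] (fun s : mR => F ((p : 'rV[R]_N * R) + (s : R) *: e)).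
Proof.
move=> mF; have mL := measurableT_comp mF (measurable_line e).
have mp : measurable_fun setT (fun s : mR => (p, s) : (HT * mR)%type).
  exact: measurable_fun_pair.
exact: (measurableT_comp mL mp).
Qed.

(** The cut-off to [[0, d]] is moved into the integrand, which makes [line_integral] a partial
    integral on a product, ready for Tonelli. *)
Let line_restrict e d F : HT * mR -> \bar R :=
  (fun q => F ((q.1 : 'rV[R]_N * R) + (q.2 : R) *: e)) \_ (snd @^-1` [set` `[0, d]]).

Let measurable_line_restrict e d F : measurable_fun setT F ->
  measurable_fun setT (line_restrict e d F).
Proof.
move=> mF; apply/(measurable_restrictT _ _).1.
  rewrite -[X in measurable X]setTI.
  by apply: measurable_snd => //; exact: measurable_itv.
apply: measurable_funTS; exact: (measurableT_comp mF (measurable_line e)).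
Qed.

Let line_integralE e d F : line_integral e d F = fubini_F mu (line_restrict e d F).
Proof.
apply/funext => p; rewrite /line_integral /fubini_F [LHS]integral_mkcond.
by apply: eq_integral => s _; rewrite /line_restrict !patchE.
Qed.

Lemma measurable_line_integral e d F : (forall p, (0 <= F p)%E) ->
  measurable_fun setT F -> measurable_fun setT (line_integral e d F).
Proof.
move=> F0 mF; rewrite line_integralE.
apply: measurable_fun_fubini_tonelli_F.
  exact: measurable_line_restrict.
by move=> q; apply: erestrict_ge0.
Qed.

(* A copy of [lebesgue_half], whose own type forgets sigma-finiteness. *)
Definition sigma_finite_half : set HT -> \bar R := @lebesgue_half R N.

HB.instance Definition _ := Measure.copy sigma_finite_half (@lebesgue_half R N).

Let sigma_finite_half_subproof : sigma_finite setT sigma_finite_half.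
Proof.
have /sigma_finiteP[A [AT ndA Aoo]] := sigma_finiteT (@lebesgue_rV R N).
have /sigma_finiteP[B [BT ndB Boo]] := sigma_finiteT mu.
exists (fun k => A k `*` B k).
  apply/esym; rewrite -subTset => -[x y] _.
  have [k _ Akx] : (\bigcup_k A k) x by rewrite -AT.
  have [l _ Bly] : (\bigcup_k B k) y by rewrite -BT.
  exists (maxn k l) => //; split => /=.
    by apply: (subsetPset _ _ (ndA _ _ (leq_maxl k l))).
  by apply: (subsetPset _ _ (ndB _ _ (leq_maxr k l))).
move=> k; have [mA Ak] := Aoo k; have [mB Bk] := Boo k.
split; first exact: measurableX.
by rewrite /sigma_finite_half/lebesgue_half/= product_measure1E// lte_mul_pinfty// ge0_fin_numE.
Qed.

HB.instance Definition _ := @Measure_isSigmaFinite.Build _ _ _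
  sigma_finite_half sigma_finite_half_subproof.

(** Tonelli and translation invariance: for each fixed [s] the inner integral is that of [F]
    translated by [s *: e], and a translation is [affine_map] with scale 1. *)
Lemma integral_line_integral e d F : 0 < d -> (forall p, (0 <= F p)%E) ->
  measurable_fun setT F ->
  (\int[lebesgue_half]_p line_integral e d F p =
   d%:E * \int[lebesgue_half]_p F p)%E.
Proof.
move=> d0 F0 mF; rewrite line_integralE.
have mG := measurable_line_restrict e d mF.
have G0 q : (0 <= line_restrict e d F q)%E by exact: erestrict_ge0.
transitivity (\int[sigma_finite_half]_p fubini_F mu (line_restrict e d F) p)%E => //.
rewrite fubini_tonelli//.
transitivity (\int[mu]_(s in `[0%R, d]) cst (\int[lebesgue_half]_p F p)%E s)%E.
  rewrite [RHS]integral_mkcond; apply: eq_integral => s _.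
  rewrite /fubini_G patchE; case: ifPn => sd; last first.
    by apply: integral0_eq => p _; rewrite /line_restrict patchE ifN.
  transitivity (1%:E * \int[lebesgue_half]_p F p)%E; last by rewrite mul1e.
  have -> : 1 = (1 ^- N.+1) :> R by rewrite expr1n invr1.
  rewrite -(ge0_integral_affine_map (- (s *: e.1)) (- (s * e.2)))//.
  apply: eq_integral => p _; rewrite /line_restrict patchE ifT//.
  by rewrite /affine_map !opprK scale1r mul1r.
rewrite integral_cst//= lebesgue_measure_itv/= lte_fin d0 oppr0 adde0.
by rewrite muleC.
Qed.

End line_integral.

Lemma ge0_integral_eq0_ae d (T : measurableType d) (R : realType)
    (mu : {measure set T -> \bar R}) (D : set T) (f : T -> \bar R) :
  measurable D -> measurable_fun D f -> (forall x, D x -> (0 <= f x)%E) ->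
  (\int[mu]_(x in D) f x = 0)%E -> {ae mu, forall x, D x -> f x = 0%E}.
Proof.
move=> mD mf f0 If; apply/(ae_eq_integral_abs mu mD mf).
by rewrite -If; apply: eq_integral => x /set_mem Dx; rewrite gee0_abs// f0.
Qed.

(** * Limits of directional derivatives *)

Section directional_limit.
Context {R : realType} {N : nat}.
Local Notation mR := (measurableTypeR R).
Local Notation HT := ('rV[R]_N * mR)%type.
Local Notation mu := (@lebesgue_measure R).
Implicit Types (e : 'rV[R]_N * R) (F : HT -> \bar R) (d : R).

Let aeF : Filter (nbhs (almost_everywhere (@lebesgue_half R N))) :=
  ae_filter_ringOfSetsType (@lebesgue_half R N).
Let aeF1 : Filter (nbhs (almost_everywhere mu)) := ae_filter_ringOfSetsType mu.

Lemma half_space_line e (p : HT) (s : R) : 0 <= e.2 -> 0 <= s ->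
  half_space p -> half_space ((p : 'rV[R]_N * R) + s *: e).
Proof.
by move=> e0 s0 p0; rewrite /half_space /= ltr_wpDr// mulr_ge0.
Qed.

(** The indicator of the exceptional null set has total line integral 0, so almost every segment
    meets that set in a null set of parameters. Since [0 <= e.2], the segment stays in the
    half-space. *)
Lemma ae_half_space_line e (P : HT -> Prop) : 0 <= e.2 ->
  {ae lebesgue_half, forall p, half_space p -> P p} ->
  {ae lebesgue_half, forall p : HT, half_space p ->
    {ae mu, forall s, `[0, 1]%classic s -> P ((p : 'rV[R]_N * R) + (s : R) *: e)}}.
Proof.
move=> e0 [A [mA A0 PA]].
pose F : HT -> \bar R := EFin \o (\1_A : HT -> R).
have F0 p : (0 <= F p)%E by rewrite lee_fin.
have mF : measurable_fun setT F by exact/measurable_EFinP.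
have mLF := measurable_line_integral e 1 F0 mF.
have LF0 p : (0 <= line_integral e 1 F p)%E by exact: integral_ge0.
have : (\int[lebesgue_half]_p line_integral e 1 F p = 0)%E.
  by rewrite integral_line_integral// /F integral_indic// setIT A0 mule0.
move=> /(ge0_integral_eq0_ae measurableT mLF (fun p _ => LF0 p)).
apply: (@filterS _ _ aeF) => p /(_ I) Lp0 p0.
have /ge0_integral_eq0_ae : (line_integral e 1 F p = 0)%E := Lp0.
move=> /(_ (measurable_itv _)) H.
have {H}H := H (measurable_funTS (measurable_along_line e p mF)) (fun s _ => F0 _).
apply: filterS H => s Hs s01; have Fs := Hs s01.
apply: contrapT => NP.
have Ap : A ((p : 'rV[R]_N * R) + s *: e).
  apply: PA => /= Pp; apply/NP/Pp/half_space_line => //.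
  by move: s01; rewrite /= in_itv/= => /andP[].
by move/eqP: Fs; rewrite /F/= indicE mem_set// eqe oner_eq0.
Qed.

(** The power is monotone, increasing or decreasing with the sign of [a], so its minimum over
    [[y, y + 1]] sits at an endpoint. *)
Lemma powR_min_le (a y z : R) : 0 < y -> y <= z <= y + 1 ->
  Num.min (y `^ a) ((y + 1) `^ a) <= z `^ a.
Proof.
move=> y0 /andP[yz zy]; have z0 : 0 < z by exact: lt_le_trans yz.
rewrite ge_min; have [a0|a0] := leP 0 a; apply/orP; [left|right].
  by rewrite ge0_ler_powR ?nnegrE ?(ltW y0) ?(ltW z0).
rewrite -[a]opprK !(powRN _ (- a)) lef_pV2 ?posrE ?powR_gt0//; last first.
  by rewrite addr_gt0.
by rewrite ge0_ler_powR ?nnegrE ?oppr_ge0 ?(ltW a0) ?(ltW z0) ?addr_ge0 ?(ltW y0).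
Qed.

(** Fatou gives lower limit 0 for the line integrals at almost every [p], that is, smallness for
    infinitely many [n]; these [n] depend on [p]. *)
Lemma directional_limit_frequently (a : R) e (q : nat -> HT -> R) :
  0 <= e.2 <= 1 ->
  (forall n, measurable_fun setT (q n)) ->
  (\int[lebesgue_half]_(p in half_space) (p.2 `^ a * q n p ^+ 2)%:E)%E
     @[n --> \oo] --> 0%E ->
  {ae lebesgue_half, forall p, half_space p ->
    forall eps, 0 < eps -> forall n0, exists2 n, (n0 <= n)%N &
      (line_integral e 1 (fun p => (q n p ^+ 2)%:E) p < eps%:E)%E}.
Proof.
move=> /andP[e0 e1] mq q0.
(* A lower bound of the weight along the segment from [p] to [p + e], whose height grows by at most
   1; it lets the weight be removed from the line integral. *)
pose omega (p : HT) := Num.min (p.2 `^ a) ((p.2 + 1) `^ a).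
have momega : measurable_fun setT omega.
  apply: measurable_minr.
    exact: (measurableT_comp (measurable_powR a) measurable_snd).
  apply: (measurableT_comp (measurable_powR a)).
  by apply: measurable_funD => //; exact: measurable_snd.
have omega0 p : half_space p -> 0 < omega p.
  by move=> p0; rewrite lt_min !powR_gt0// addr_gt0.
have mq2 n : measurable_fun setT (fun p => (q n p ^+ 2)%:E).
  by apply/measurable_EFinP; exact: measurable_funX.
have q20 n p : (0 <= (q n p ^+ 2)%:E)%E by rewrite lee_fin sqr_ge0.
pose L n := line_integral e 1 (fun p => (q n p ^+ 2)%:E).
have mL n : measurable_fun setT (L n) by exact: measurable_line_integral.
have L0 n p : (0 <= L n p)%E by exact: integral_ge0.
pose u n p := ((omega p)%:E * L n p)%E.
have mu_ n : measurable_fun setT (u n).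
  by apply: emeasurable_funM => //; exact/measurable_EFinP.
have u0 n p : half_space p -> (0 <= u n p)%E.
  by move=> p0; rewrite mule_ge0// lee_fin ltW// omega0.
pose W n : HT -> \bar R := (fun p : HT => (p.2 `^ a * q n p ^+ 2)%:E) \_ half_space.
have mW n : measurable_fun setT (W n).
  apply/(measurable_restrictT _ measurable_half_space)/measurable_funTS.
  apply/measurable_EFinP; apply: measurable_funM; last exact: measurable_funX.
  exact: (measurableT_comp (measurable_powR a) measurable_snd).
have W0 n p : (0 <= W n p)%E.
  by apply: erestrict_ge0 => x _; rewrite lee_fin mulr_ge0 ?sqr_ge0 ?powR_ge0.
(* Inside the line integral [omega p] is at most the weight at the moving point, and integrating
   over unit segments preserves the total integral. *)
have uW n : (\int[lebesgue_half]_(p in half_space) u n p <=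
    \int[lebesgue_half]_(p in half_space) (p.2 `^ a * q n p ^+ 2)%:E)%E.
  apply: (@le_trans _ _ (\int[lebesgue_half]_p line_integral e 1 (W n) p)%E).
    apply: (@le_trans _ _ (\int[lebesgue_half]_(p in half_space) line_integral e 1 (W n) p)%E).
      apply: ge0_le_integral => //.
      - exact: measurable_half_space.
      - by move=> p p0; exact: u0.
      - exact: measurable_funTS.
      - by apply: measurable_funTS; exact: measurable_line_integral.
      move=> p p0; rewrite /u /L /line_integral -ge0_integralZl//; last 2 first.
      - by apply: measurable_funTS; exact: (measurable_along_line e p (mq2 n)).
      - by rewrite lee_fin ltW// omega0.
      apply: ge0_le_integral => //.
      - by move=> s _; rewrite -EFinM lee_fin mulr_ge0 ?sqr_ge0// ltW// omega0.
      - apply: measurable_funTS; apply: emeasurable_funM => //.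
        exact: (measurable_along_line e p (mq2 n)).
      - by apply: measurable_funTS; exact: (measurable_along_line e p (mW n)).
      move=> s /=; rewrite in_itv/= => /andP[s0 s1].
      rewrite /W patchE mem_set; last exact: half_space_line.
      rewrite -EFinM lee_fin ler_wpM2r ?sqr_ge0//.
      apply: powR_min_le => //=.
      rewrite lerDl mulr_ge0//= lerD2l.
      by rewrite (le_trans _ e1)// ler_piMl.
    apply: ge0_subset_integral => //; first exact: measurable_half_space.
      exact: measurable_line_integral.
    by move=> p _; exact: integral_ge0.
  by rewrite integral_line_integral// mul1e /W -integral_mkcond.
have l0 p : half_space p -> (0 <= limn_einf (u ^~ p))%E.
  by move=> p0; apply: limn_einf_ge0 => n; exact: u0.
have Iu : (\int[lebesgue_half]_(p in half_space) limn_einf (u ^~ p) = 0)%E.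
  apply/eqP; rewrite eq_le; apply/andP; split; last exact: integral_ge0.
  apply: (@le_trans _ _ (limn_einf (fun n => \int[lebesgue_half]_(p in half_space) u n p)%E)).
    apply: fatou => //; first exact: measurable_half_space.
    by move=> n; exact: measurable_funTS.
  exact: limn_einf_le_cvg uW q0.
have : {ae lebesgue_half, forall p, half_space p -> limn_einf (u ^~ p) = 0%E}.
  apply: ge0_integral_eq0_ae Iu => //; first exact: measurable_half_space.
  by apply: measurable_funTS; exact: measurable_fun_limn_einf.
apply: (@filterS _ _ aeF) => p up p0 eps eps0 n0.
have : (limn_einf (u ^~ p) < (omega p * eps)%:E)%E.
  by rewrite up// lte_fin mulr_gt0// omega0.
move=> /(frequently_lt_limn_einf n0)[n n0n un]; exists n => //.
by move: un; rewrite /u EFinM lte_pmul2l// lte_fin omega0.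
Qed.

(** Along almost every segment [line_limit_eq0] makes [h] vanish at almost every parameter; Tonelli
    carries this back to the half-space. *)
Lemma directional_limit_eq0 (a : R) e (t : nat -> 'rV[R]_N * R -> R) (h : HT -> R) :
  0 <= e.2 <= 1 ->
  (forall n, Ck 1 (t n)) -> measurable_fun setT h ->
  {ae lebesgue_half, forall p, half_space p -> t n p @[n --> \oo] --> 0} ->
  (\int[lebesgue_half]_(p in half_space)
     (p.2 `^ a * ('D_e (t n) p - h p) ^+ 2)%:E)%E @[n --> \oo] --> 0%E ->
  {ae lebesgue_half, forall p, half_space p -> h p = 0}.
Proof.
move=> e01 Ct mh t0 th0; have /andP[e0 e1] := e01.
have cD n : continuous ('D_e (t n)) by have [_ _] := Ct n; exact.
pose q n (p : HT) := 'D_e (t n) p - h p.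
have mq n : measurable_fun setT (q n).
  by apply: measurable_funB => //; exact: continuous_measurable_rV_prod.
have freq := directional_limit_frequently e01 mq th0.
have tline := ae_half_space_line e0 t0.
have hline : {ae lebesgue_half, forall p : HT, half_space p -> {ae mu, forall s,
    s \in `]0, 1[ -> h ((p : 'rV[R]_N * R) + (s : R) *: e) = 0}}.
  have : {ae lebesgue_half, forall p : HT, half_space p ->
      [/\ t n p @[n --> \oo] --> 0,
         {ae mu, forall s, `[0, 1]%classic s ->
           t n ((p : 'rV[R]_N * R) + (s : R) *: e) @[n --> \oo] --> 0} &
         forall eps, 0 < eps -> forall n0, exists2 n, (n0 <= n)%N &
         (line_integral e 1 (fun p => (q n p ^+ 2)%:E) p < eps%:E)%E]}.
    apply: (@filterS3 _ _ aeF _ _ _ _ _ t0 tline freq) => p p1 p2 p3 p0.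
    by split; [exact: p1|exact: p2|exact: p3].
  apply: (@filterS _ _ aeF) => p + p0 => /(_ p0)[tp tps fp].
  pose g n s := t n ((p : 'rV[R]_N * R) + (s : R) *: e).
  have gE n : (g n)^`()%classic = (fun s => 'D_e (t n) ((p : 'rV[R]_N * R) + s *: e)).
    by apply/funext => s; exact: derive1_line.
  apply: (line_limit_eq0 (g := g)).
  - by move=> n s; apply: derivable_line; have [_ + _] := Ct n; exact.
  - move=> n; rewrite gE => s.
    have cl : {for s, continuous (fun s : R => (p : 'rV[R]_N * R) + s *: e)}.
      by apply: cvgD; [exact: cvg_cst|apply: cvgZl; exact: cvg_id].
    exact: (continuous_comp cl (cD n _)).
  - exact: measurable_along_line.
  - move=> eps eps0 n0; have [n n0n fn] := fp _ eps0 n0.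
    by exists n; [exact: n0n|rewrite gE; exact: fn].
  - by rewrite /g; under eq_fun do rewrite scale0r addr0.
  - apply: (@filterS _ _ aeF1) tps => s ts s01; apply: ts => /=.
    exact: subset_itv_oo_cc.
(* The bad set is exhausted by its parts above height [1 / (k + 1)]. Each part is null because the
   integral over all starting points of its line integral is [d] times its measure. *)
pose B : set HT := half_space `&` [set p | h p != 0].
have mB : measurable B.
  apply: measurableI; first exact: measurable_half_space.
  rewrite -[X in measurable X]setTI.
  rewrite (_ : [set p | h p != 0] = h @^-1` (~` [set 0])); last first.
    by apply/seteqP; split => p /= /eqP.
  by apply: mh => //; apply: measurableC; exact: measurable_set1.
pose S k : set HT := [set p | k.+1%:R^-1 < p.2].
have mS k : measurable (B `&` S k).
  apply: measurableI => //.
  rewrite (_ : S k = snd @^-1` [set` `]k.+1%:R^-1, +oo[ : interval R]); last first.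
    by apply/seteqP; split => p /=; rewrite in_itv/= andbT.
  rewrite -[X in measurable X]setTI.
  by apply: measurable_snd => //; exact: measurable_itv.
have S0 k : lebesgue_half (B `&` S k) = 0%E.
  pose F : HT -> \bar R := EFin \o (\1_(B `&` S k) : HT -> R).
  have F0 p : (0 <= F p)%E by rewrite lee_fin.
  have mF : measurable_fun setT F by exact/measurable_EFinP.
  (* Starting points outside the half-space also enter the integral. With [d] below [1 / (k + 1)]
     and [e.2 <= 1], segments issued from them cannot reach [S k]. *)
  pose d : R := k.+2%:R^-1.
  have d0 : 0 < d by rewrite invr_gt0.
  have dk : d < k.+1%:R^-1 by rewrite ltf_pV2 ?posrE ?ltr0n// ltr_nat.
  have d1 : d < 1 by rewrite invf_lt1// ltr1n.
  have : (d%:E * lebesgue_half (B `&` S k) = 0)%E.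
    rewrite -(setIT (B `&` S k)) -integral_indic//.
    rewrite -(integral_line_integral e d0 F0 mF).
    rewrite (ae_eq_integral (cst 0%E)) ?integral0//.
      exact: measurable_line_integral.
    apply: (@filterS _ _ aeF) hline => p hp _.
    have [p0|p0] := boolP (p.2 <= 0).
      apply: integral0_eq => s /=; rewrite in_itv/= => /andP[s0 sd].
      rewrite /F/= indicE memNset// => -[_] /=; apply/negP; rewrite -leNgt.
      apply: le_trans (ltW dk); rewrite -[leRHS]add0r lerD//.
      by rewrite (le_trans _ sd)// ler_piMr.
    (* The endpoint [s = 0] is dropped because [hp] speaks of []0, 1[]; the other end is inside, as
       [d < 1]. *)
    rewrite /line_integral -integral_itv_obnd_cbnd; last first.
      by apply: measurable_funTS; exact: measurable_along_line.
    rewrite (ae_eq_integral (cst 0%E)) ?integral0//.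
      by apply: measurable_funTS; exact: measurable_along_line.
    have {}p0 : half_space p by rewrite /half_space/= ltNge.
    apply: (@filterS _ _ aeF1) (hp p0) => s hs /=.
    rewrite in_itv/= => /andP[s0 sd].
    rewrite /F/= indicE memNset// => -[[_ /eqP]] + _; apply; apply: hs.
    by rewrite in_itv/= s0 (le_lt_trans sd).
  by move/eqP; rewrite mule_eq0 eqe gt_eqF//= => /eqP.
have : lebesgue_half.-negligible (\bigcup_k (B `&` S k)).
  apply: negligible_bigcup => k; apply/negligibleP; [exact: mS|exact: S0].
apply: negligibleS => p /= /not_implyP[p0 /eqP hp].
have [k kp] := ltr_add_invr p0; exists k => //; split => //.
by rewrite add0r in kp.
Qed.

End directional_limit.

(** * Uniqueness of the gradient *)

Section gradient_unique.
Context {R : realType} {N : nat}.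
Local Notation mR := (measurableTypeR R).
Local Notation HT := ('rV[R]_N * mR)%type.
Implicit Types (alpha : R) (w : 'rV[R]_N * R -> R).

Let aeF : Filter (nbhs (almost_everywhere (@lebesgue_half R N))) :=
  ae_filter_ringOfSetsType (@lebesgue_half R N).

Lemma sq_euclidB (v v' : 'rV[R]_N * R) :
  sq_euclid (v - v') <= 2 * (sq_euclid v + sq_euclid v').
Proof.
have sqB (x y : R) : (x - y) ^+ 2 <= 2 * (x ^+ 2 + y ^+ 2).
  have := sqr_ge0 (x + y); rewrite sqrrB sqrrD; lra.
apply: (@le_trans _ _ (\sum_i 2 * (v.1 ord0 i ^+ 2 + v'.1 ord0 i ^+ 2) +
  2 * (v.2 ^+ 2 + v'.2 ^+ 2))).
  by apply: lerD; [apply: ler_sum => i _; rewrite !mxE|]; exact: sqB.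
by rewrite -mulr_sumr big_split/= /sq_euclid; lra.
Qed.

(** Works with squared norms throughout; the factor 2 replaces the triangle inequality and is
    harmless for limits equal to 0. *)
Lemma energyB alpha (G G' : HT -> HT) :
  measurable_fun setT G -> measurable_fun setT G' ->
  (energy alpha (fun p => (G p : 'rV[R]_N * R) - G' p)%R <=
   2%:E * (energy alpha G + energy alpha G'))%E.
Proof.
move=> mG mG'; have mH := @measurable_half_space R N.
have mD (K : HT -> HT) : measurable_fun setT K -> measurable_fun half_space
    (fun p : HT => (p.2 `^ (1 - 2 * alpha) * sq_euclid (K p))%:E).
  by move=> mK; apply: measurable_funTS; exact: measurable_energy_density.
have D0 (K : HT -> HT) (p : HT) :
    (0 <= (p.2 `^ (1 - 2 * alpha) * sq_euclid (K p))%:E)%E.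
  by rewrite lee_fin mulr_ge0 ?powR_ge0 ?sq_euclid_ge0.
rewrite /energy -(ge0_integralD _ mH (fun p _ => D0 G p) (mD _ mG)
  (fun p _ => D0 G' p) (mD _ mG')).
rewrite -ge0_integralZl//; last 2 first.
- by apply: emeasurable_funD; exact: mD.
- by move=> p _; rewrite adde_ge0.
apply: ge0_le_integral => //.
- by move=> p _; exact: (D0 (fun p => (G p : _ * R) - G' p)).
- by apply: mD; exact: measurable_vectorB.
- by apply: emeasurable_funM => //; apply: emeasurable_funD; exact: mD.
move=> p _; rewrite -EFinD -EFinM lee_fin -mulrDr mulrCA ler_wpM2l ?powR_ge0//.
exact: sq_euclidB.
Qed.

Lemma sqr_snd_le_euclid (v : 'rV[R]_N * R) : v.2 ^+ 2 <= sq_euclid v.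
Proof. by rewrite lerDr sumr_ge0// => i _; exact: sqr_ge0. Qed.

Lemma sqr_coord_le_euclid (v : 'rV[R]_N * R) i : v.1 ord0 i ^+ 2 <= sq_euclid v.
Proof.
rewrite /sq_euclid (bigD1 i)//= -addrA lerDl addr_ge0 ?sqr_ge0// sumr_ge0// => j _.
exact: sqr_ge0.
Qed.

Lemma representsB_cvg0 alpha w f f' :
  represents alpha f w -> represents alpha f' w ->
  {ae lebesgue_half, forall p, half_space p ->
    (f n p - f' n p) @[n --> \oo] --> (0 : R)}.
Proof.
move=> [_ _ fw] [_ _ f'w]; apply: (@filterS2 _ _ aeF _ _ _ _ fw f'w) => p fp f'p p0.
rewrite -[X in _ --> X](subrr (w p)); apply: cvgB; [exact: fp|exact: f'p].
Qed.

Lemma gradient_cvg_energyB alpha (f f' : nat -> 'rV[R]_N * R -> R)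
    (G G' : HT -> HT) :
  (forall n, Ck 1 (f n)) -> (forall n, Ck 1 (f' n)) ->
  measurable_fun setT G -> measurable_fun setT G' ->
  energy alpha (fun p => gradient (f n) p - G p) @[n --> \oo] --> 0%E ->
  energy alpha (fun p => gradient (f' n) p - G' p) @[n --> \oo] --> 0%E ->
  energy alpha (fun p => gradient (fun p => f n p - f' n p) p -
    ((G p : 'rV[R]_N * R) - G' p)) @[n --> \oo] --> 0%E.
Proof.
move=> Cf Cf' mG mG' fG f'G.
pose K n := (2%:E * (energy alpha (fun p => gradient (f n) p - G p)%R +
   energy alpha (fun p => gradient (f' n) p - G' p)%R))%E.
have K0 : K n @[n --> \oo] --> 0%E.
  rewrite -(mule0 2%:E); apply: cvgeZl => //.
  by rewrite -(adde0 0%E); apply: cvgeD.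
apply: squeeze_cvge (cvg_cst 0%E) K0; apply: nearW => n; rewrite ge0_energy/=.
rewrite /K; apply: le_trans (energyB _ _ _); last 2 first.
- by apply: measurable_vectorB => //; exact: measurable_gradient.
- by apply: measurable_vectorB => //; exact: measurable_gradient.
rewrite le_eqVlt; apply/orP; left; apply/eqP; congr energy.
by apply/funext => p; rewrite gradientB// !opprD addrACA.
Qed.

(** The difference of two representing sequences tends to 0 almost everywhere while its gradients
    tend to [G - G']; [directional_limit_eq0] applies in each of the N + 1 coordinate directions. *)
Lemma Xgradient_unique alpha w G G' :
  is_Xgradient alpha w G -> is_Xgradient alpha w G' ->
  {ae lebesgue_half, forall p, half_space p -> G p = G' p}.
Proof.
move=> [mG [f fw fG]] [mG' [f' f'w f'G]].
have Cf n : Ck 1 (f n) by apply: test_function_Ck; case: fw.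
have Cf' n : Ck 1 (f' n) by apply: test_function_Ck; case: f'w.
pose t n := fun p => f n p - f' n p.
have Ct n : Ck 1 (t n) by exact: CkB.
pose H := fun p => G p - G' p.
have mH : measurable_fun setT (H : HT -> HT) by exact: measurable_vectorB.
have tH := gradient_cvg_energyB Cf Cf' mG mG' fG f'G.
have t0 := representsB_cvg0 fw f'w.
(* A component of the error is dominated by its Euclidean norm, so convergence of the energies
   passes to each direction. *)
have dir e (h : HT -> R) : 0 <= e.2 <= 1 -> measurable_fun setT h ->
    (forall n p, ('D_e (t n) p - h p) ^+ 2 <= sq_euclid (gradient (t n) p - H p)) ->
    {ae lebesgue_half, forall p, half_space p -> h p = 0}.
  move=> e01 mh hle; apply: (directional_limit_eq0 (a := 1 - 2 * alpha) e01 Ct mh t0).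
  apply: squeeze_cvge (cvg_cst 0%E) tH; apply: nearW => n; apply/andP; split.
    by apply: integral_ge0 => p _; rewrite lee_fin mulr_ge0 ?sqr_ge0 ?powR_ge0.
  apply: ge0_le_integral => //.
  - exact: measurable_half_space.
  - by move=> p _; rewrite lee_fin mulr_ge0 ?sqr_ge0 ?powR_ge0.
  - apply: measurable_funTS; apply/measurable_EFinP; apply: measurable_funM.
      exact: (measurableT_comp (measurable_powR _) measurable_snd).
    apply: measurable_funX; apply: measurable_funB => //.
    by apply: continuous_measurable_rV_prod; have [_ _] := Ct n; exact.
  - apply: measurable_funTS; apply: measurable_energy_density.
    apply: measurable_vectorB => //.
    exact: (measurable_gradient (Ct n)).
  - by move=> p _; rewrite lee_fin ler_wpM2l ?powR_ge0.
have H2 : {ae lebesgue_half, forall p, half_space p -> (H p).2 = 0}.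
  apply: (dir (0, 1)).
  - by rewrite /= ler01 lexx.
  - exact: (measurableT_comp measurable_snd mH).
  - by move=> n p; exact: (sqr_snd_le_euclid (gradient (t n) p - H p)).
have H1 : {ae lebesgue_half, forall p, forall i, half_space p -> (H p).1 ord0 i = 0}.
  apply: (@filter_forall _ _ _ _ aeF) => i; apply: (dir (delta_mx 0 i, 0)).
  - by rewrite /= lexx ler01.
  - apply: (measurableT_comp (measurable_coord i)).
    exact: (measurableT_comp measurable_fst mH).
  - move=> n p; have := sqr_coord_le_euclid (gradient (t n) p - H p) i.
    by rewrite !mxE.
apply: (@filterS2 _ _ aeF _ _ _ _ H1 H2) => p p1 p2 p0.
apply/eqP; rewrite -subr_eq0; apply/eqP.
rewrite -[LHS]/(H p) (surjective_pairing (H p)) p2//; congr pair.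
by apply/rowP => i; rewrite p1// mxE.
Qed.

Lemma Xgradient_energy_unique alpha w G G' :
  is_Xgradient alpha w G -> is_Xgradient alpha w G' ->
  energy alpha G = energy alpha G'.
Proof.
move=> GP G'P; have GG' := Xgradient_unique GP G'P.
apply: ge0_ae_eq_integral.
- exact: measurable_half_space.
- by apply: measurable_funTS; apply: measurable_energy_density; case: GP.
- by apply: measurable_funTS; apply: measurable_energy_density; case: G'P.
- by move=> p _; rewrite lee_fin mulr_ge0 ?powR_ge0 ?sq_euclid_ge0.
- by move=> p _; rewrite lee_fin mulr_ge0 ?powR_ge0 ?sq_euclid_ge0.
- by apply: (@filterS _ _ aeF) GG' => p + p0 => ->.
Qed.

End gradient_unique.

(** * Uniqueness of the trace *)

Section trace_estimate.
Context {R : realType}.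
Local Notation mR := (measurableTypeR R).
Local Notation mu := (@lebesgue_measure R).

Lemma continuous_powR_gt0 (a x : R) : 0 < x -> {for x, continuous (@powR R ^~ a)}.
Proof.
move=> x0; apply/differentiable_continuous; rewrite -derivable1_diffP.
by apply: derivable_powR; rewrite in_itv/= x0.
Qed.

(* Cauchy-Schwarz with the weights s^(1 - 2 alpha) and s^(2 alpha - 1), by
   integrating [2 k phi' <= k^2 s^(2 alpha - 1) + s^(1 - 2 alpha) phi'^2] for
   the optimal constant [k]. *)
Lemma sqr_increment_le_weighted_pos (alpha : R) (phi : R -> R) (d y : R) :
  0 < alpha -> 0 < d -> d < y ->
  (forall s, derivable phi s 1) -> continuous phi^`()%classic ->
  (((phi y - phi d) ^+ 2)%:E <= (y `^ (2 * alpha) / (2 * alpha))%:E *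
    \int[mu]_(s in `]0%R, +oo[) (s `^ (1 - 2 * alpha) * (phi^`()%classic s) ^+ 2)%:E)%E.
Proof.
move=> alpha0 d0 dy dphi cphi; have y0 : 0 < y by exact: lt_trans dy.
set C := y `^ (2 * alpha) / (2 * alpha).
have a20 : 0 < 2 * alpha by rewrite mulr_gt0.
have C0 : 0 < C by rewrite divr_gt0// powR_gt0.
(* This maximises [2 * k * (phi y - phi d) - k ^+ 2 * C], with maximum
   [(phi y - phi d) ^+ 2 / C]. *)
pose k := (phi y - phi d) / C.
pose psi s := 2 * k * phi s - k ^+ 2 / (2 * alpha) * s `^ (2 * alpha).
pose f s := 2 * k * phi^`()%classic s - k ^+ 2 * s `^ (2 * alpha - 1).
pose g s := s `^ (1 - 2 * alpha) * (phi^`()%classic s) ^+ 2.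
have phiD (s : R) : is_derive s (1 : R) phi (phi^`()%classic s).
  by rewrite derive1E; exact: derivableP.
have psiD (s : R) : 0 < s -> is_derive s (1 : R) psi (f s).
  move=> s0; have := is_derive1_powR (2 * alpha) s0 => powD.
  rewrite (_ : f s = 2 * k *: phi^`()%classic s -
     k ^+ 2 / (2 * alpha) *: (2 * alpha * s `^ (2 * alpha - 1))).
    exact: is_deriveB.
  rewrite /f; congr (_ - _); rewrite -[RHS]/(k ^+ 2 / (2 * alpha) *
    (2 * alpha * s `^ (2 * alpha - 1))) [RHS]mulrA divfK// lt0r_neq0//.
have cont_f s : 0 < s -> {for s, continuous f}.
  move=> s0; apply: cvgB; apply: cvgM; try exact: cvg_cst.
    exact: cphi.
  exact: continuous_powR_gt0.
have cont_g s : 0 < s -> {for s, continuous g}.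
  move=> s0; apply: cvgM; first exact: continuous_powR_gt0.
  by apply: (@cvgM _ _ _ _ (phi^`()%classic) (phi^`()%classic)); exact: cphi.
have cont_psi s : 0 < s -> {for s, continuous psi}.
  move=> s0; apply/differentiable_continuous; rewrite -derivable1_diffP.
  by have [] := psiD s s0.
have dypos s : s \in `[d, y] -> 0 < s.
  by rewrite in_itv/= => /andP[ds _]; exact: lt_le_trans ds.
have wcont (h : R -> R) : (forall s : R, 0 < s -> {for s, continuous h}) ->
    {within `[d, y], continuous h}.
  move=> ch; apply: continuous_in_subspaceT => s; rewrite inE => sdy.
  exact/ch/dypos.
have FTC : (\int[mu]_(s in `[d, y]) (f s)%:E = (psi y - psi d)%:E)%E.
  rewrite EFinB; apply: continuous_FTC2 => //.
  - exact: wcont.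
  - split.
    + by move=> s /subset_itv_oo_cc/dypos s0; have [] := psiD s s0.
    + by apply: cvg_at_right_filter; exact: cont_psi.
    + by apply: cvg_at_left_filter; exact: cont_psi.
  - move=> s /subset_itv_oo_cc/dypos s0.
    by rewrite derive1E; have [_ ->] := psiD s s0.
have le1 : ((psi y - psi d)%:E <= \int[mu]_(s in `[d, y]) (g s)%:E)%E.
  rewrite -FTC; apply: le_integral => //.
  - by apply: continuous_compact_integrable; [exact: segment_compact|exact: wcont].
  - by apply: continuous_compact_integrable; [exact: segment_compact|exact: wcont].
  move=> s; rewrite inE => /dypos s0; rewrite lee_fin /f /g.
  set P := s `^ (1 - 2 * alpha); set c := phi^`()%classic s.
  have P0 : 0 < P by exact: powR_gt0.
  have -> : s `^ (2 * alpha - 1) = P^-1 by rewrite -powRN opprB.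
  rewrite -subr_ge0 (_ : _ - _ = (P * c - k) ^+ 2 / P); last first.
    by field; rewrite lt0r_neq0.
  by rewrite divr_ge0 ?sqr_ge0// ltW.
have le2 : (\int[mu]_(s in `[d, y]) (g s)%:E <=
    \int[mu]_(s in `]0%R, +oo[) (g s)%:E)%E.
  apply: ge0_subset_integral => //.
  - apply: measurable_funTS; apply/measurable_EFinP; apply: measurable_funM.
      exact: measurable_powR.
    by apply: measurable_funX; exact: continuous_measurable_fun.
  - by move=> s _; rewrite lee_fin mulr_ge0 ?powR_ge0 ?sqr_ge0.
  - by move=> s /dypos s0; rewrite /= in_itv/= s0.
have le0 : (phi y - phi d) ^+ 2 / C <= psi y - psi d.
  have -> : (phi y - phi d) ^+ 2 / C = 2 * k * (phi y - phi d) - k ^+ 2 * C.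
    by rewrite /k; field; rewrite lt0r_neq0.
  (* The integral of s^(2 alpha - 1) over [[d, y]] falls short of [C] by d^(2 alpha) / (2 alpha),
     and this term has the favourable sign. *)
  rewrite -subr_ge0 (_ : _ - _ = k ^+ 2 / (2 * alpha) * d `^ (2 * alpha)).
    by rewrite mulr_ge0 ?powR_ge0// divr_ge0 ?sqr_ge0// ltW.
  by rewrite /psi /C; field; rewrite lt0r_neq0.
rewrite (_ : (phi y - phi d) ^+ 2 = C * ((phi y - phi d) ^+ 2 / C)); last first.
  by rewrite mulrC divfK// lt0r_neq0.
rewrite EFinM lee_wpmul2l// ?lee_fin ?(ltW C0)//.
by apply: le_trans le2; apply: le_trans le1; rewrite lee_fin.
Qed.

(** Let [d] decrease to 0 in the previous bound, whose right-hand side does not depend on [d].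
    Starting at [d > 0] keeps the powers of [s] away from their singularity at 0. *)
Lemma sqr_increment_le_weighted (alpha : R) (phi : R -> R) (y : R) :
  0 < alpha -> 0 < y ->
  (forall s, derivable phi s 1) -> continuous phi^`()%classic ->
  (((phi y - phi 0) ^+ 2)%:E <= (y `^ (2 * alpha) / (2 * alpha))%:E *
    \int[mu]_(s in `]0%R, +oo[) (s `^ (1 - 2 * alpha) * (phi^`()%classic s) ^+ 2)%:E)%E.
Proof.
move=> alpha0 y0 dphi cphi; set M := (_ * _)%E.
have posle d : 0 < d -> d < y -> (((phi y - phi d) ^+ 2)%:E <= M)%E.
  by move=> d0 dy; exact: sqr_increment_le_weighted_pos.
have M0 : (0 <= M)%E.
  apply: mule_ge0.
    by rewrite lee_fin divr_ge0 ?powR_ge0// mulr_ge0// ltW.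
  by apply: integral_ge0 => s _; rewrite lee_fin mulr_ge0 ?powR_ge0 ?sqr_ge0.
have [->|Mfin] := eqVneq M +oo%E; first by rewrite leey.
move: posle; rewrite -(@fineK _ M) ?ge0_fin_numE ?ltey//.
move=> posle; rewrite lee_fin.
have cphi0 : (phi y - phi d) ^+ 2 @[d --> 0^'+] --> (phi y - phi 0) ^+ 2.
  apply: cvg_at_right_filter.
  have c0 : phi y - phi d @[d --> 0] --> phi y - phi 0.
    apply: cvgB; first exact: cvg_cst.
    by apply/differentiable_continuous; rewrite -derivable1_diffP.
  exact: (cvgM c0 c0).
apply: (cvgr_to_le cphi0); near=> d.
rewrite -lee_fin; apply: posle; near: d; [exact: nbhs_right_gt|exact: nbhs_right_lt].
Unshelve. all: by end_near. Qed.
End trace_estimate.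

(** * Traces as limits of horizontal slices *)

Section trace_unique.
Context {R : realType} {N : nat}.
Local Notation mR := (measurableTypeR R).
Local Notation HT := ('rV[R]_N * mR)%type.
Local Notation mu := (@lebesgue_measure R).
Implicit Types (alpha y : R) (u v : 'rV[R]_N -> mR).

Let aeX : Filter (nbhs (almost_everywhere (@lebesgue_rV R N))) :=
  ae_filter_ringOfSetsType (@lebesgue_rV R N).
Let aeF1 : Filter (nbhs (almost_everywhere mu)) := ae_filter_ringOfSetsType mu.

Lemma measurable_slice (phi : 'rV[R]_N * R -> R) y : continuous phi ->
  measurable_fun [set: 'rV[R]_N] ((fun x => phi (x, y)) : _ -> mR).
Proof.
move=> cphi; apply: (measurableT_comp (continuous_measurable_rV_prod cphi)).
exact: measurable_fun_pair.
Qed.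

Lemma measurable_sqr u : measurable_fun setT u ->
  measurable_fun setT (fun x => (u x ^+ 2)%:E).
Proof. by move=> mu_; apply/measurable_EFinP; exact: measurable_funX. Qed.

Lemma vertical_lineE (x : 'rV[R]_N) (y : R) :
  ((x, 0) : 'rV[R]_N * R) + y *: (0, 1) = (x, y).
Proof. by congr pair; rewrite /= ?scaler0 ?addr0// [_ *: _]mulr1 add0r. Qed.

Lemma continuous_vertical_line (x : 'rV[R]_N) : continuous (fun y : R => (x, y)).
Proof.
move=> y; rewrite (_ : (fun y => _) =
    (fun y : R => ((x, 0) : 'rV[R]_N * R) + y *: (0, 1))); last first.
  by apply/funext => s; rewrite vertical_lineE.
by apply: cvgD; [exact: cvg_cst|apply: cvgZl; exact: cvg_id].
Qed.

(** The one-dimensional estimate on each vertical line is integrated in [x] by Tonelli; the vertical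
    derivative is one component of the gradient. *)
Lemma sq_L2_slice_increment alpha (phi : 'rV[R]_N * R -> R) y :
  0 < alpha -> 0 < y -> Ck 1 phi ->
  (sq_L2 (fun x => phi (x, y) - phi (x, 0))%R <=
   (y `^ (2 * alpha) / (2 * alpha))%:E * energy alpha (gradient phi))%E.
Proof.
move=> alpha0 y0 Cphi; have [cphi dphi Dphi] := Cphi.
set C := _%:E.
have C0 : (0 <= C)%E by rewrite lee_fin divr_ge0 ?powR_ge0// mulr_ge0// ltW.
pose q (p : HT) : \bar R :=
  (p.2 `^ (1 - 2 * alpha) * 'D_(0, 1) phi p ^+ 2)%:E.
have q0 p : (0 <= q p)%E by rewrite lee_fin mulr_ge0 ?powR_ge0 ?sqr_ge0.
have mq : measurable_fun setT q.
  apply/measurable_EFinP; apply: measurable_funM.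
    exact: (measurableT_comp (measurable_powR _) measurable_snd).
  by apply: measurable_funX; exact: continuous_measurable_rV_prod.
have mqh : measurable_fun setT (q \_ half_space).
  apply/(measurable_restrictT _ measurable_half_space); exact: measurable_funTS.
have qh0 p : (0 <= (q \_ half_space) p)%E by exact: erestrict_ge0.
have slice x : (((phi (x, y) - phi (x, 0)) ^+ 2)%:E <=
    C * fubini_F mu (q \_ half_space) x)%E.
  pose g (s : R) := phi (((x, 0) : 'rV[R]_N * R) + s *: (0, 1)).
  have gE : g^`()%classic = (fun s : R => 'D_(0, 1) phi (x, s)).
    by apply/funext => s; rewrite derive1_line vertical_lineE.
  have dg s : derivable g s 1 by exact: derivable_line.
  have cg : continuous g^`()%classic.
    rewrite gE => s.
    exact: (continuous_comp (@continuous_vertical_line x s) (Dphi _ _)).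
  have := sqr_increment_le_weighted alpha0 y0 dg cg.
  rewrite gE /g !vertical_lineE => /le_trans; apply; apply: lee_wpmul2l => //.
  rewrite integral_mkcond le_eqVlt; apply/orP; left; apply/eqP.
  apply: eq_integral => s _; rewrite !patchE; congr (if _ then _ else _).
  by apply/idP/idP; rewrite !inE /half_space/= in_itv/= andbT.
have step : (\int[lebesgue_rV N]_x fubini_F mu (q \_ half_space) x <=
    energy alpha (gradient phi))%E.
  rewrite -fubini_tonelli1// /energy /lebesgue_half -integral_mkcond.
  apply: ge0_le_integral => //.
  - exact: measurable_half_space.
  - exact: measurable_funTS.
  - apply: measurable_funTS; apply: measurable_energy_density.
    exact: measurable_gradient.
  - move=> p _; rewrite lee_fin ler_wpM2l ?powR_ge0//.
    exact: (sqr_snd_le_euclid (gradient phi p)).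
apply: (@le_trans _ _ (\int[lebesgue_rV N]_x (C * fubini_F mu (q \_ half_space) x))%E).
  apply: ge0_le_integral => //.
  - by move=> x _; rewrite lee_fin sqr_ge0.
  - apply: measurable_sqr; apply: measurable_funB; exact: measurable_slice.
  - apply: emeasurable_funM => //; exact: measurable_fun_fubini_tonelli_F.
rewrite ge0_integralZl//; last 2 first.
- exact: measurable_fun_fubini_tonelli_F.
- by move=> x _; exact: integral_ge0.
exact: lee_wpmul2l.
Qed.

(** Lower semicontinuity of the L^2 norm. It serves twice below: for [n] tending to infinity at a
    fixed height, then for the height tending to 0. *)
Lemma sq_L2_fatou (u : nat -> 'rV[R]_N -> mR) (v : 'rV[R]_N -> mR)
    (b : (\bar R)^nat) (l : \bar R) :
  (forall n, measurable_fun setT (u n)) -> measurable_fun setT v ->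
  {ae lebesgue_rV N, forall x, u n x @[n --> \oo] --> (v x : R)} ->
  (forall n, (sq_L2 (u n) <= b n)%E) -> b @ \oo --> l ->
  (sq_L2 v <= l)%E.
Proof.
move=> mun mv uv ub bl.
have l0 x : (0 <= limn_einf (fun n => (u n x ^+ 2)%:E))%E.
  by apply: limn_einf_ge0 => n; rewrite lee_fin sqr_ge0.
have -> : sq_L2 v =
    (\int[lebesgue_rV N]_x limn_einf (fun n => (u n x ^+ 2)%:E))%E.
  apply: ge0_ae_eq_integral => //.
  - exact: measurable_sqr.
  - by apply: measurable_fun_limn_einf => n; exact: measurable_sqr.
  - by move=> x _; rewrite lee_fin sqr_ge0.
  apply: (@filterS _ _ aeX) uv => x uvx _.
  have ux2 : (u n x ^+ 2)%:E @[n --> \oo] --> (v x ^+ 2)%:E.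
    by apply: cvg_EFin; [exact: nearW|exact: (cvgM uvx uvx)].
  by rewrite (cvg_limn_einf_sup ux2).1.
apply: le_trans (limn_einf_le_cvg ub bl).
apply: fatou => // [n|n x _]; first exact: measurable_sqr.
by rewrite lee_fin sqr_ge0.
Qed.

Lemma sq_L2B u v : measurable_fun setT u -> measurable_fun setT v ->
  (sq_L2 (fun x => u x - v x)%R <= 2%:E * (sq_L2 u + sq_L2 v))%E.
Proof.
move=> mu_ mv.
have s0 (w : 'rV[R]_N -> R) x : (0 <= (w x ^+ 2)%:E)%E by rewrite lee_fin sqr_ge0.
rewrite /sq_L2 -(ge0_integralD _ measurableT (fun x _ => s0 u x) (measurable_sqr mu_)
  (fun x _ => s0 v x) (measurable_sqr mv)).
have mD : measurable_fun setT (fun x => (u x ^+ 2)%:E + (v x ^+ 2)%:E)%E.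
  by apply: emeasurable_funD; exact: measurable_sqr.
rewrite -ge0_integralZl//; last by move=> x _; rewrite adde_ge0.
apply: ge0_le_integral => //.
- by move=> x _; rewrite lee_fin sqr_ge0.
- by apply: measurable_sqr; exact: measurable_funB.
- by apply: emeasurable_funM.
move=> x _; rewrite -EFinD -EFinM lee_fin.
have := sqr_ge0 (u x + v x); rewrite sqrrB sqrrD; lra.
Qed.

(** Tonelli with the height as outer variable. *)
Lemma ae_slice (P : HT -> Prop) :
  {ae lebesgue_half, forall p, half_space p -> P p} ->
  {ae mu, forall y : R, 0 < y -> {ae lebesgue_rV N, forall x, P (x, y)}}.
Proof.
move=> [A [mA A0 PA]].
pose F : HT -> \bar R := EFin \o (\1_A : HT -> R).
have F0 p : (0 <= F p)%E by rewrite lee_fin.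
have mF : measurable_fun setT F by exact/measurable_EFinP.
have : (\int[mu]_y fubini_G (lebesgue_rV N) F y = 0)%E.
  rewrite -(fubini_tonelli2 F)//.
  rewrite -[LHS]/(\int[lebesgue_half]_p F p)%E /F integral_indic// setIT.
  exact: A0.
have G0 y : (0 <= fubini_G (lebesgue_rV N) F y)%E by exact: integral_ge0.
have mG := measurable_fun_fubini_tonelli_G F mF F0 (m1 := lebesgue_rV N).
move=> /(ge0_integral_eq0_ae measurableT mG (fun y _ => G0 y)).
apply: (@filterS _ _ aeF1) => y /(_ I) Gy y0.
have mFy : measurable_fun setT (fun x : 'rV[R]_N => F (x, y)).
  by apply: (measurableT_comp mF); exact: measurable_fun_pair.
have := ge0_integral_eq0_ae measurableT mFy (fun x _ => F0 (x, y)) Gy.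
apply: (@filterS _ _ aeX) => x /(_ I) Fx.
apply: contrapT => NP.
have Ap : A (x, y) by apply: PA => /= Pp; exact/NP/Pp.
by move/eqP: Fx; rewrite /F/= indicE mem_set// eqe oner_eq0.
Qed.

Lemma exists_small_height alpha (P : R -> Prop) (e : R) : 0 < alpha -> 0 < e ->
  {ae mu, forall y, 0 < y -> P y} ->
  exists y, [/\ 0 < y, y < e, y `^ (2 * alpha) / (2 * alpha) <= e & P y].
Proof.
move=> alpha0 e0 aeP; have a20 : 0 < 2 * alpha by rewrite mulr_gt0.
(* The second entry is the height at which y^(2 alpha) / (2 alpha) equals [e]; the interval []0, b[]
   has positive measure and so contains a height where [P] holds. *)
pose b := Num.min e ((e * (2 * alpha)) `^ (2 * alpha)^-1).
have b0 : 0 < b by rewrite lt_min e0 powR_gt0// mulr_gt0.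
apply: contrapT => NP; apply: (not_negligible_itvoo b0 aeP) => y /=.
rewrite in_itv/= lt_min => /and3P[y0 ye yb] Py; apply: NP; exists y.
split => //; last exact: Py.
rewrite ler_pdivrMr//.
rewrite (_ : e * _ = ((e * (2 * alpha)) `^ (2 * alpha)^-1) `^ (2 * alpha)).
  by rewrite ge0_ler_powR ?nnegrE ?powR_ge0// ltW.
by rewrite -powRrM mulVf ?lt0r_neq0// powRr1// mulr_ge0// ltW.
Qed.

(** At a good height [y], letting [n] tend to infinity bounds the squared norm of [v + D y] by a
    multiple of y^(2 alpha). Then [y] tends to 0 along good heights, where [D y] vanishes by
    continuity of [t n0]. *)
Lemma trace_limit_eq0 alpha (t : nat -> 'rV[R]_N * R -> R) v (n0 : nat) :
  0 < alpha -> (forall n, Ck 1 (t n)) -> measurable_fun setT v ->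
  (forall n, (n0 <= n)%N ->
    (energy alpha (gradient (fun p => t n p - t n0 p)%R) <= 1)%E) ->
  {ae lebesgue_half, forall p, half_space p -> t n p @[n --> \oo] --> 0} ->
  sq_L2 (fun x => restrict0 (t n) x - v x) @[n --> \oo] --> 0%E ->
  {ae lebesgue_rV N, forall x, v x = 0}.
Proof.
move=> alpha0 Ct mv Et t0 tv.
have ct n : continuous (t n) by have [] := Ct n.
(* The hypothesis bounds the energies of the differences [t n - t n0] only, so the increment of
   [t n0] is split off. *)
pose D y x := t n0 (x, y) - t n0 (x, 0).
have mD y : measurable_fun setT (D y : 'rV[R]_N -> mR).
  by apply: measurable_funB; exact: measurable_slice.
have vD y : 0 < y -> {ae lebesgue_rV N, forall x, t n (x, y) @[n --> \oo] --> 0} ->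
    (sq_L2 (fun x => v x + D y x)%R <=
     2%:E * (y `^ (2 * alpha) / (2 * alpha))%:E)%E.
  move=> y0 ty; set C := (_ / (2 * alpha))%:E.
  pose u1 n x := restrict0 (t (n + n0)%N) x - v x.
  pose phi n p := t (n + n0)%N p - t n0 p.
  pose u2 n x := phi n (x, y) - phi n (x, 0).
  have Cphi n : Ck 1 (phi n) by exact: CkB.
  have mu1 n : measurable_fun setT (u1 n : 'rV[R]_N -> mR).
    by apply: measurable_funB => //; exact: measurable_restrict0.
  have mu2 n : measurable_fun setT (u2 n : 'rV[R]_N -> mR).
    by apply: measurable_funB; apply: measurable_slice; have [] := Cphi n.
  (* Equal to [v x + D y x - t (n + n0) (x, y)], whose last term vanishes in the limit; [u1] tends
     to 0 in L^2 and [u2] obeys the slice estimate. The shift by [n0] makes the energy bound valid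
     for every [n]. *)
  pose u n x := - u1 n x - u2 n x.
  have b_cvg : (2%:E * (sq_L2 (u1 n) + C))%E @[n --> \oo] --> (2%:E * C)%E.
    apply: cvgeZl => //; rewrite -[X in _ --> X]add0e; apply: cvgeD => //.
      by move: tv; rewrite -(cvg_shiftn n0).
    exact: cvg_cst.
  apply: (@sq_L2_fatou u (fun x => v x + D y x) _ _ _ _ _ _ b_cvg).
  - by move=> n; apply: measurable_funB; [apply: measurable_funN; exact: mu1|exact: mu2].
  - by apply: measurable_funD; [exact: mv|exact: mD].
  - apply: (@filterS _ _ aeX) ty => x tx.
    rewrite (_ : (fun n => u n x) = (fun n => (v x + D y x) - t (n + n0)%N (x, y))).
      rewrite -[X in _ --> X]subr0; apply: cvgB; first exact: cvg_cst.
      by move: tx; rewrite -(cvg_shiftn n0).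
    apply/funext => n; rewrite /u /u1 /u2 /phi /D /restrict0; ring.
  - move=> n; apply: le_trans (sq_L2B (measurable_funN (mu1 n)) (mu2 n)) _.
    apply: lee_wpmul2l => //; apply: leeD.
      by rewrite /sq_L2; under eq_integral do rewrite sqrrN.
    apply: le_trans (sq_L2_slice_increment alpha0 y0 (Cphi n)) _.
    rewrite -[leRHS]mule1; apply: lee_wpmul2l; last by apply: Et; rewrite leq_addl.
    by rewrite lee_fin divr_ge0 ?powR_ge0// mulr_ge0// ltW.
have good := ae_slice t0.
have heights k : exists y, [/\ 0 < y, y < k.+1%:R^-1,
    y `^ (2 * alpha) / (2 * alpha) <= k.+1%:R^-1 &
    {ae lebesgue_rV N, forall x, t n (x, y) @[n --> \oo] --> 0}].
  by apply: exists_small_height.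
pose y_ k := projT1 (cid (heights k)).
have yP k := projT2 (cid (heights k)).
have y_cvg : y_ k @[k --> \oo] --> 0.
  apply: (squeeze_cvgr _ (cvg_cst 0) (cvg_harmonic)).
  by apply: nearW => k; have [/ltW -> /ltW -> _ _] := yP k.
have v0 : (sq_L2 v = 0)%E.
  apply/eqP; rewrite eq_le ge0_sq_L2 andbT.
  have b_cvg : (2%:E * (k.+1%:R^-1)%:E)%E @[k --> \oo] --> (0%E : \bar R).
    rewrite -(mule0 2%:E); apply: cvgeZl => //; apply: cvg_EFin.
      exact: nearW.
    exact: cvg_harmonic.
  apply: (@sq_L2_fatou (fun k x => v x + D (y_ k) x) v _ _ _ mv _ _ b_cvg).
  - by move=> k; apply: measurable_funD; [exact: mv|exact: mD].
  - apply: aeW => x; rewrite -[X in _ --> X]addr0; apply: cvgD; first exact: cvg_cst.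
    rewrite -(subrr (t n0 (x, 0))); apply: cvgB; last exact: cvg_cst.
    have xy_cvg := cvg_comp _ _ y_cvg (@continuous_vertical_line x 0).
    exact: (cvg_comp _ _ xy_cvg (ct n0 (x, 0))).
  - move=> k; have [y0 _ yk ty] := yP k.
    by apply: le_trans (vD _ y0 ty) _; rewrite lee_wpmul2l// lee_fin.
have v20 x : [set: 'rV[R]_N] x -> (0 <= (v x ^+ 2)%:E)%E.
  by rewrite lee_fin sqr_ge0.
apply: (@filterS _ _ aeX) (ge0_integral_eq0_ae measurableT (measurable_sqr mv) v20 v0).
by move=> x /(_ I)/eqP; rewrite eqe sqrf_eq0 => /eqP.
Qed.

End trace_unique.

(** * Uniqueness of the trace in X^alpha and the critical Lebesgue norm *)

Section trace_class_unique.
Context {R : realType} {N : nat}.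
Local Notation mR := (measurableTypeR R).
Implicit Types (alpha : R) (w : 'rV[R]_N * R -> R).

(** Tolerance 1/2 makes both energies at most 1/4, and [energyB] gives 2 (1/4 + 1/4) = 1. *)
Lemma energy_cauchyB alpha (f f' : nat -> 'rV[R]_N * R -> R) :
  (forall n, Ck 1 (f n)) -> (forall n, Ck 1 (f' n)) ->
  X_cauchy alpha f -> X_cauchy alpha f' ->
  exists n0, forall n, (n0 <= n)%N ->
    (energy alpha (gradient (fun p => (f n p - f' n p) - (f n0 p - f' n0 p))%R)
     <= 1)%E.
Proof.
move=> Cf Cf' cf cf'; have e0 : 0 < 2^-1 :> R by rewrite invr_gt0.
have small (g : nat -> 'rV[R]_N * R -> R) : X_cauchy alpha g -> exists n1, forall m n, (n1 <= m)%N ->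
    (n1 <= n)%N ->
    (energy alpha (gradient (fun p => g m p - g n p)%R) <= (2^-1 ^+ 2)%:E)%E.
  move=> /(_ _ e0)[n1 H]; exists n1 => m n mn1 nn1.
  apply: le_trans (ltW (H _ _ mn1 nn1)).
  by rewrite /sq_Xnorm leeDl// ge0_sq_L2.
have [n1 H1] := small _ cf; have [n2 H2] := small _ cf'.
exists (maxn n1 n2) => n; rewrite geq_max => /andP[nn1 nn2].
have E1 := H1 n (maxn n1 n2) nn1 (leq_maxl _ _).
have E2 := H2 n (maxn n1 n2) nn2 (leq_maxr _ _).
set n0 := maxn n1 n2 in E1 E2 *.
have Cg : Ck 1 (fun p => f n p - f n0 p) by exact: CkB.
have Cg' : Ck 1 (fun p => f' n p - f' n0 p) by exact: CkB.
rewrite (_ : gradient _ = (fun p => gradient (fun p => f n p - f n0 p) p -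
    gradient (fun p => f' n p - f' n0 p) p)); last first.
  apply/funext => p; rewrite -gradientB//; congr (gradient _ p).
  by apply/funext => z; ring.
apply: le_trans (energyB _ (measurable_gradient Cg) (measurable_gradient Cg')) _.
apply: (@le_trans _ _ (2%:E * ((2^-1 ^+ 2)%:E + (2^-1 ^+ 2)%:E))%E).
  by apply: lee_wpmul2l; [rewrite lee_fin|exact: (leeD E1 E2)].
by rewrite -EFinD -EFinM lee_fin; lra.
Qed.

(** [trace_limit_eq0] for the difference of two representing sequences, whose restrictions tend to
    [v - v'] in L^2. *)
Lemma Xtrace_unique alpha w (v v' : 'rV[R]_N -> R) : 0 < alpha ->
  is_Xtrace alpha w v -> is_Xtrace alpha w v' ->
  {ae lebesgue_rV N, forall x, v x = v' x}.
Proof.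
move=> alpha0 [mv [f fw fv]] [mv' [f' f'w f'v']].
have Cf n : Ck 1 (f n) by apply: test_function_Ck; case: fw.
have Cf' n : Ck 1 (f' n) by apply: test_function_Ck; case: f'w.
have [n0 En0] : exists n0, forall n, (n0 <= n)%N -> (energy alpha (gradient
    (fun p => (f n p - f' n p) - (f n0 p - f' n0 p))%R) <= 1)%E.
  by apply: energy_cauchyB => //; [case: fw|case: f'w].
pose t n p := f n p - f' n p.
have tv : sq_L2 (fun x => restrict0 (t n) x - (v x - v' x)) @[n --> \oo] --> 0%E.
  pose u n x := restrict0 (f n) x - v x.
  pose u' n x := restrict0 (f' n) x - v' x.
  have K0 : (2%:E * (sq_L2 (u n) + sq_L2 (u' n)))%E @[n --> \oo] --> 0%E.
    rewrite -(mule0 2%:E); apply: cvgeZl => //.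
    by rewrite -(adde0 0%E); apply: cvgeD.
  apply: squeeze_cvge (cvg_cst 0%E) K0; apply: nearW => n; rewrite ge0_sq_L2/=.
  have mu_ : measurable_fun setT (u n : _ -> mR).
    by apply: measurable_funB => //; apply: measurable_restrict0; case: (Cf n).
  have mu' : measurable_fun setT (u' n : _ -> mR).
    by apply: measurable_funB => //; apply: measurable_restrict0; case: (Cf' n).
  apply: le_trans (sq_L2B mu_ mu'); rewrite le_eqVlt; apply/orP; left; apply/eqP.
  by congr sq_L2; apply/funext => x; rewrite /u /u' /t /restrict0; ring.
have := @trace_limit_eq0 R N alpha t (fun x => v x - v' x) n0 alpha0 _ _ En0
  (representsB_cvg0 fw f'w) tv.
have Ct n : Ck 1 (t n) by exact: CkB.
move=> /(_ Ct (measurable_funB mv mv')).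
apply: (@filterS _ _ (ae_filter_ringOfSetsType (@lebesgue_rV R N))) => x /eqP.
by rewrite subr_eq0 => /eqP.
Qed.

(** The critical exponent times [(N - 2 alpha) / 2] equals [N], so the power of the amplitude
    cancels the Jacobian [s ^- N]. *)
Lemma Lnorm_rescale alpha s (x0 : 'rV[R]_N) (v : 'rV[R]_N -> R) :
  0 < s -> 2 * alpha < N%:R -> measurable_fun setT (v : _ -> mR) ->
  ('N[lebesgue_rV N]_(critical_exponent N alpha)%:E
     [EFin \o (fun x => amplitude N alpha s * v (s *: (x - x0)))%R] =
   'N[lebesgue_rV N]_(critical_exponent N alpha)%:E [EFin \o v])%E.
Proof.
move=> s0 aN mv; rewrite unlock /Lnorm; set p := critical_exponent N alpha.
apply: (congr1 (fun z => z `^ p^-1)%E).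
pose F x := (`|v x| `^ p)%:E.
have F0 x : (0 <= F x)%E by rewrite lee_fin powR_ge0.
have mF : measurable_fun setT F.
  apply/measurable_EFinP; apply: (measurableT_comp (measurable_powR p)).
  exact: measurableT_comp.
have A0 : 0 < amplitude N alpha s by exact: amplitude_gt0.
transitivity (\int[lebesgue_rV N]_x
    ((amplitude N alpha s `^ p)%:E * F (s *: (x - x0))%R))%E.
  apply: eq_integral => x _ /=.
  by rewrite normrM (gtr0_norm A0) powRM// ?(ltW A0)// EFinM.
rewrite ge0_integralZl//; last 2 first.
- exact: (measurableT_comp mF (measurable_affine_rV s x0)).
- by rewrite lee_fin powR_ge0.
rewrite (ge0_integral_affine_rV x0 s0 mF F0) muleA -EFinM.
rewrite (_ : _ * _ = 1) ?mul1e//.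
rewrite /amplitude -powRrM -[s ^+ N]powR_mulrn ?(ltW s0)// -powRN -powRD; last first.
  by apply/implyP => _; rewrite lt0r_neq0.
rewrite [X in _ `^ X](_ : _ = 0) ?powRr0// /p /critical_exponent; field.
by rewrite subr_eq0 gt_eqF.
Qed.

Lemma ae_eq_Lnorm (p : R) (v v' : 'rV[R]_N -> R) :
  measurable_fun setT (v : _ -> mR) -> measurable_fun setT (v' : _ -> mR) ->
  {ae lebesgue_rV N, forall x, v x = v' x} ->
  ('N[lebesgue_rV N]_p%:E [EFin \o v] = 'N[lebesgue_rV N]_p%:E [EFin \o v'])%E.
Proof.
move=> mv mv' vv'; rewrite unlock /Lnorm; apply: (congr1 (fun z => z `^ p^-1)%E).
have mF (z : 'rV[R]_N -> mR) : measurable_fun setT z ->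
    measurable_fun setT (fun x => (`|(EFin \o z) x| `^ p)%E).
  move=> mz; rewrite (_ : (fun _ => _) = (fun x => (`|z x| `^ p)%:E)).
    apply/measurable_EFinP; apply: (measurableT_comp (measurable_powR p)).
    exact: measurableT_comp.
  by apply/funext => x.
apply: ge0_ae_eq_integral => //.
- exact: mF.
- exact: mF.
- by move=> x _; exact: poweR_ge0.
- by move=> x _; exact: poweR_ge0.
apply: (@filterS _ _ (ae_filter_ringOfSetsType (@lebesgue_rV R N))) vv'.
by move=> x vx _; rewrite /= vx.
Qed.

End trace_class_unique.

(** * Invariance of the homogeneous norm and of the critical norm of the trace *)

Theorem lemma4p1 (R : realType) (N : nat) (hN : (1 <= N)%N)
    (alpha : R) (halpha0 : 0 < alpha) (halpha1 : alpha < 1)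
    (hN2 : 2 * alpha < N%:R) (hN4 : N%:R <= 4 * alpha)
    (w : 'rV[R]_N * R -> R) (hw : Xspace alpha w)
    (sigma : R) (hsigma : 0 < sigma) (x0 : 'rV[R]_N) :
  [/\ Xspace alpha (rescale alpha sigma x0 w),
      Xdot_norm alpha (rescale alpha sigma x0 w) = Xdot_norm alpha w
    & ('N[lebesgue_rV N]_(critical_exponent N alpha)%:E
         [EFin \o Xtrace alpha (rescale alpha sigma x0 w)] =
       'N[lebesgue_rV N]_(critical_exponent N alpha)%:E
         [EFin \o Xtrace alpha w])%E].
Proof.
have sV0 : 0 < sigma^-1 by rewrite invr_gt0.
pose w' := rescale alpha sigma x0 w.
have w'K : rescale alpha sigma^-1 (- (sigma *: x0)) w' = w by exact: rescaleV.
split.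
- by have [s ws] := hw; exists (fun n => rescale alpha sigma x0 (s n));
    exact: represents_rescale.
- apply: (congr1 (fun z => z `^ 2^-1)%E).
  have [[G wG]|noG] := pselect (exists G, is_Xgradient alpha w G).
    have w'G := is_Xgradient_rescale x0 hsigma wG.
    rewrite -(Xgradient_energy_unique w'G); last first.
      by apply: xgetPex; eexists; exact: w'G.
    rewrite energy_rescale//; last by case: wG.
    by apply: (Xgradient_energy_unique wG); apply: xgetPex; exists G.
  (* Without a gradient of [w], both sides take the default field 0: since [w] is a rescaling of
     [w'], a gradient of [w'] would yield one of [w]. *)
  rewrite /Xgradient !xgetPN// => G w'G; apply: noG; first by exists G.
  by rewrite -w'K; eexists; exact: (is_Xgradient_rescale _ sV0 w'G).
- have [[v wv]|nov] := pselect (exists v, is_Xtrace alpha w v).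
    have w'v := is_Xtrace_rescale x0 hsigma wv.
    have wX : is_Xtrace alpha w (Xtrace alpha w) by apply: xgetPex; exists v.
    have w'X : is_Xtrace alpha w' (Xtrace alpha w').
      by apply: xgetPex; eexists; exact: w'v.
    have mv : measurable_fun setT (v : _ -> measurableTypeR R) by case: wv.
    (* The traces picked by [xget] agree with [v] and its rescaling up to null sets, which the norm
       does not see. *)
    rewrite (ae_eq_Lnorm _ _ _ (Xtrace_unique halpha0 w'X w'v)); last 2 first.
    + by case: w'X.
    + by case: w'v.
    rewrite Lnorm_rescale//; apply: ae_eq_Lnorm => //; first by case: wX.
    exact: (Xtrace_unique halpha0 wv wX).
  rewrite /Xtrace !xgetPN// => v w'v; apply: nov; first by exists v.
  by rewrite -w'K; eexists; exact: (is_Xtrace_rescale _ sV0 w'v).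
Qed.
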